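(* Let $C$ be a 2-interval-homogeneous circle (it is then highly interval-homogeneous). (1) Every automorphism of the group $\mathrm{Aut}(C)$ and every automorphism of the group $\mathrm{Aut}(C^{rel})$ is conjugation by a unique element of $\mathrm{Aut}(\bar C^{rel})$, and identifying automorphisms with these conjugators one has $\mathrm{Aut}(C^{rel})\le\mathrm{Aut}(\mathrm{Aut}(C^{rel}))\le\mathrm{Aut}(\mathrm{Aut}(C))\le\mathrm{Aut}(\bar C^{rel})$. (2)(a) If there is no orbit $M\ne C$ of $\mathrm{Aut}(C)$ on $\bar C$ such that $C\cong M$ and the action of $\mathrm{Aut}(C)$ on $M$ is all of $\mathrm{Aut}(M)$, then $|\mathrm{Outer}(\mathrm{Aut}(C))|\le 2$. (b) If there is no orbit $M\ne C$ of $\mathrm{Aut}(C)$ on $\bar C$ such that ($C\cong M$ or $C\cong M^*$) and the action of $\mathrm{Aut}(C)$ on $M$ is all of $\mathrm{Aut}(M)$, then $\mathrm{Aut}(C)$ is a complete group. (c) If there is no orbit $M\ne C$ of $\mathrm{Aut}(C^{rel})$ on $\bar C$ such that ($C\cong M$ or $C\cong M^*$) and the action of $\mathrm{Aut}(C^{rel})$ on $M^{rel}$ is all of $\mathrm{Aut}(M^{rel})$, then $\mathrm{Aut}(C^{rel})$ is a complete group. (3) Every automorphism of $\mathrm{Aut}(\bar C)$ is conjugation by a unique element of $\mathrm{Aut}(\bar C^{rel})$, i.e. $\mathrm{Aut}(\mathrm{Aut}(\bar C))=\mathrm{Aut}(\bar C^{rel})$, and $\mathrm{Aut}(\bar C^{rel})$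 is a complete group.
   Context: A circle is $C=\mathrm{CR}(L)=(L,\mathrm{Cr})$ where $L$ is a dense linear order with at most one endpoint and $\mathrm{Cr}(x,y,z)$ iff $x<y<z$ or $y<z<x$ or $z<x<y$. $\mathrm{Aut}(C)$ is the group of bijections preserving $\mathrm{Cr}$ (orientation-preserving); $C^{rel}$ is the equal-orientation structure on $C$, whose automorphism group $\mathrm{Aut}(C^{rel})$ consists of the bijections of $C$ that preserve or reverse orientation. $C^*$ is $C$ with reversed orientation. $\bar C$ is the Dedekind completion: the completion $\bar L$ of $L$ with one endpoint adjoined if it has none, circularized; automorphisms extend uniquely to $\bar C$. Bounded $C$-intervals are $(x,y)=\{z\in C:\mathrm{Cr}(x,z,y)\}$ for $x\ne y$; for $n\ge3$, $\mathrm{Crs}(I_1,\ldots,I_n)$ means all $I_k$ are nonempty and $\mathrm{Cr}(x_i,x_j,x_k)$ whenever $i<j<k$ and $x_m\in I_m$; $\mathrm{Crs}(I_1,I_2)$ means $I_1\cap I_2=\emptyset$. $C$ is $n$-interval-homogeneous if for all $C$-intervals with $\mathrm{Crs}(I_1,\ldots,I_n)$ and $\mathrm{Crs}(J_1,\ldots,J_n)$ some $g\in\mathrm{Aut}(C)$ has $g(I_k)\cap J_k\ne\emptyset$ for all $k$; highly = for all $n$. A group is complete if it has trivial center and all its automorphisms are inner. $\mathrm{Outer}(H)=\mathrm{Aut}(H)/\mathrm{Inner}(H)$.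
   Formalization: In (2)(b), M = C is also excluded in the alternative C ≅ M*, as the claim fails when C ≅ C* (e.g. the real circle); in (2), if C is not itself an orbit, M ranges over unions of orbits instead of orbits, since otherwise the hypotheses hold vacuously and the conclusions can fail. *)

(* Defs.v *)
From HB Require Import structures.
From mathcomp Require Import all_boot all_order.
From mathcomp Require Import boolp classical_sets functions cardinality.

Set Implicit Arguments.
Unset Strict Implicit.
Unset Printing Implicit Defensive.

Import Order.TTheory.

Local Open Scope order_scope.
Local Open Scope group_scope.
Local Open Scope classical_set_scope.

(* The group of all bijections of a type. The product is the composition of
   functions, (u * v) x = u (v x), so that u * v * u^-1 is v conjugated by u. *)

Section Sym.
Variable T : Type.

Record sym := Sym {
  sym_fun :> T -> T;
  sym_inv : T -> T;
  symK : cancel sym_fun sym_inv;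
  symVK : cancel sym_inv sym_fun }.

HB.instance Definition _ := gen_eqMixin sym.
HB.instance Definition _ := gen_choiceMixin sym.

Lemma sym_eq (u v : sym) : u =1 v -> u = v.
Proof.
case: u v => [f f' fK f'K] [g g' gK g'K] /= fg.
have {}fg : f = g by apply/funext.
rewrite -{g}fg in gK g'K *.
have f'g' : f' = g' by apply/funext => x; rewrite -{1}(g'K x) fK.
rewrite -{g'}f'g' in gK g'K *.
by congr Sym; exact: Prop_irrelevance.
Qed.

Definition sym_one : sym := @Sym id id (fun=> erefl) (fun=> erefl).
Definition sym_opp (u : sym) : sym := Sym (@symVK u) (@symK u).
Definition sym_mul (u v : sym) : sym :=
  Sym (can_comp (@symK u) (@symK v)) (can_comp (@symVK v) (@symVK u)).

Lemma sym_mulA : associative sym_mul.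
Proof. by move=> u v w; exact: sym_eq. Qed.
Lemma sym_mul1 : left_id sym_one sym_mul.
Proof. by move=> u; exact: sym_eq. Qed.
Lemma sym_mulr1 : right_id sym_one sym_mul.
Proof. by move=> u; exact: sym_eq. Qed.
Lemma sym_mulV : left_inverse sym_one sym_opp sym_mul.
Proof. by move=> u; apply: sym_eq => x /=; rewrite symK. Qed.
Lemma sym_mulrV : right_inverse sym_one sym_opp sym_mul.
Proof. by move=> u; apply: sym_eq => x /=; rewrite symVK. Qed.

HB.instance Definition _ :=
  isGroup.Build sym sym_mulA sym_mul1 sym_mulr1 sym_mulV sym_mulrV.

Lemma symME (u v : sym) x : (u * v) x = u (v x). Proof. by []. Qed.
Lemma symVE (u : sym) x : u (u^-1 x) = x. Proof. exact: symVK. Qed.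

End Sym.

(* The circle CR(L) has carrier L, and cyc is its relation Cr. *)

Section Circle.
Context {d : Order.disp_t} (L : orderType d).

Definition dense_order : Prop := forall x y : L, x < y -> exists z, x < z < y.

Definition endpoint (x : L) : Prop :=
  (forall y, x <= y) \/ (forall y, y <= x).

Definition is_circle : Prop :=
  dense_order /\ (forall x y : L, endpoint x -> endpoint y -> x = y).

Definition cyc (x y z : L) : bool :=
  [|| x < y < z, y < z < x | z < x < y].

Definition orient_preserving : {pred sym L} :=
  [pred g : sym L |
    `[< forall x y z, cyc (g x) (g y) (g z) = cyc x y z >]].

Definition orient_reversing : {pred sym L} :=
  [pred g : sym L |
    `[< forall x y z, cyc (g z) (g y) (g x) = cyc x y z >]].

Definition aut_pred : {pred sym L} := [pred g | g \in orient_preserving].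

Definition autrel_pred : {pred sym L} :=
  [pred g | (g \in orient_preserving) || (g \in orient_reversing)].

Lemma aut_group_closed : group_closed aut_pred.
Proof.
split; first by apply/asboolP.
move=> u v /asboolP uP /asboolP vP; apply/asboolP => x y z.
by rewrite !symME uP -vP !symVE.
Qed.

Lemma autrel_group_closed : group_closed autrel_pred.
Proof.
split; first by apply/orP; left; apply/asboolP.
move=> u v /orP[] /asboolP uP /orP[] /asboolP vP; apply/orP.
- by left; apply/asboolP => x y z; rewrite !symME uP -vP !symVE.
- by right; apply/asboolP => x y z; rewrite !symME uP -vP !symVE.
- by right; apply/asboolP => x y z; rewrite !symME uP -vP !symVE.
- by left; apply/asboolP => x y z; rewrite !symME uP -vP !symVE.
Qed.

(* Aut(C) and Aut(C^rel) for C = CR(L) *)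
Definition Aut : Type := {g : sym L | aut_pred g}.
Definition AutRel : Type := {g : sym L | autrel_pred g}.

HB.instance Definition _ := SubChoice.on Aut.
HB.instance Definition _ :=
  SubChoice_isSubGroup.Build (sym L) aut_pred Aut aut_group_closed.

HB.instance Definition _ := SubChoice.on AutRel.
HB.instance Definition _ :=
  SubChoice_isSubGroup.Build (sym L) autrel_pred AutRel autrel_group_closed.

Definition cinterval (x y : L) : set L := [set z | cyc x z y].

Definition is_cinterval (I : set L) : Prop :=
  exists x y, x <> y /\ I = cinterval x y.

Definition Crs (n : nat) (I : 'I_n -> set L) : Prop :=
  if n == 2 then forall i j, i <> j -> I i `&` I j = set0
  else (forall i, I i !=set0) /\
       (forall i j k : 'I_n, (i < j < k)%N ->
          forall x y z, I i x -> I j y -> I k z -> cyc x y z).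

Definition interval_homogeneous (n : nat) : Prop :=
  forall I J : 'I_n -> set L,
    (forall k, is_cinterval (I k)) -> (forall k, is_cinterval (J k)) ->
    Crs I -> Crs J ->
    exists g : Aut, forall k, ((val g : L -> L) @` I k) `&` J k !=set0.

Definition highly_interval_homogeneous : Prop :=
  forall n, interval_homogeneous n.

End Circle.

Arguments Aut {d} L.
Arguments AutRel {d} L.

(* Isomorphisms A ≅ B and A ≅ B^* between subsets of circles, with the induced
   cyclic relations. *)

Section Isomorphism.
Context {d d' : Order.disp_t} {L : orderType d} {L' : orderType d'}.
Implicit Types (A : set L) (B : set L') (f : L -> L').

Definition is_iso A B f : Prop := set_bij A B f /\
  (forall x y z, A x -> A y -> A z -> cyc (f x) (f y) (f z) = cyc x y z).

Definition is_antiiso A B f : Prop := set_bij A B f /\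
  (forall x y z, A x -> A y -> A z -> cyc (f z) (f y) (f x) = cyc x y z).

Definition iso A B : Prop := exists f, is_iso A B f.
Definition antiiso A B : Prop := exists f, is_antiiso A B f.

End Isomorphism.

(* Points of the Dedekind completion are represented by closed lower cuts. The
   nonempty cuts that are bounded above form the completion of L; if L has no
   endpoint then neither does its completion, and the empty cut is the
   endpoint that is adjoined (as a least element). *)

Section Completion.
Context {d : Order.disp_t} (L : orderType d).

Definition is_cut (A : set L) : Prop := lbound (ubound A) = A /\
  (has_sup A \/ (A = set0 /\ ~ exists x : L, endpoint x)).

Record completion := Completion { cut : set L; cutP : is_cut cut }.

Lemma cut_inj : injective cut.
Proof.
case=> A AP [B BP] /= AB; rewrite -{B}AB in BP *.
by congr Completion; exact: Prop_irrelevance.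
Qed.

HB.instance Definition _ := gen_eqMixin completion.
HB.instance Definition _ := gen_choiceMixin completion.

Definition completion_le : rel completion :=
  fun p q => `[< cut p `<=` cut q >].

Lemma completion_le_refl : reflexive completion_le.
Proof. by move=> p; apply/asboolP. Qed.

Lemma completion_le_anti : antisymmetric completion_le.
Proof.
by move=> p q /andP[/asboolP pq /asboolP qp]; apply/cut_inj/seteqP.
Qed.

Lemma completion_le_trans : transitive completion_le.
Proof.
move=> q p r /asboolP pq /asboolP qr.
exact/asboolP/(subset_trans pq).
Qed.

Lemma completion_le_total : total completion_le.
Proof.
move=> p q; have [pq|npq] := pselect (cut p `<=` cut q).
  by apply/orP; left; apply/asboolP.
apply/orP; right; apply/asboolP => y qy.
have [x [px nqx]] : exists x, cut p x /\ ~ cut q x.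
  apply: contrapT => nx; apply: npq => x px.
  by apply: contrapT => nqx; apply: nx; exists x.
have [pc _] := cutP p; have [qc _] := cutP q.
rewrite -pc => u pu; apply: le_trans (pu x px).
have [xy|/ltW //] := leP x y; case: nqx.
by rewrite -qc => v qv; apply: le_trans xy _; exact: qv.
Qed.

HB.instance Definition _ := Order.Le_isPOrder.Build d completion
  completion_le_refl completion_le_anti completion_le_trans.
HB.instance Definition _ :=
  Order.POrder_isTotal.Build d completion completion_le_total.

Lemma emb_cutP (x : L) : is_cut [set y | y <= x].
Proof.
split.
  apply/seteqP; split=> y /=.
    by apply=> z.
  by move=> yx z; exact.
left; split; first by exists x => /=.
by exists x => y.
Qed.

Definition emb (x : L) : completion := Completion (emb_cutP x).

End Completion.

Section AbstractGroup.
Variable G : groupType.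

Definition is_aut (phi : G -> G) : Prop :=
  bijective phi /\ {morph phi : x y / x * y}.

Definition is_inner (phi : G -> G) : Prop :=
  exists g, forall x, phi x = g * x * g^-1.

(* Outer(G) = Aut(G)/Inner(G), as a set of left cosets *)
Definition Outer : set (set (G -> G)) :=
  [set [set phi \o psi | psi in [set psi | is_inner psi]]
     | phi in [set phi | is_aut phi]].

Definition complete_group : Prop :=
  (forall z : G, (forall x, z * x = x * z) -> z = 1) /\
  (forall phi : G -> G, is_aut phi -> is_inner phi).

Definition is_subgroup (A : set G) : Prop := group_closed (mem A).

End AbstractGroup.

Arguments Outer G : clear implicits.
Arguments complete_group G : clear implicits.

(* In this section G is Aut(C) or Aut(C^rel), where C = CR(L). *)

Section ActionOnCompletion.
Context {d : Order.disp_t} (L : orderType d).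
Context {P : pred (sym L)} (G : subGroupType P).
Local Notation Lbar := (completion L).

Definition extends (u : sym Lbar) (g : sym L) : Prop :=
  forall x, u (emb x) = emb (g x).

(* phi g = h g h^-1 for all g, after extending g and phi g to the completion *)
Definition conj_by (phi : G -> G) (h : AutRel Lbar) : Prop :=
  forall g : G, exists2 u : AutRel Lbar,
    extends (val u) (val g) & extends (val (h * u * h^-1)) (val (phi g)).

(* Aut(G), with each automorphism identified with its conjugators *)
Definition conjugators : set (AutRel Lbar) :=
  [set h | exists2 phi : G -> G, is_aut phi & conj_by phi h].

(* G, with each element identified with its extension *)
Definition extensions : set (AutRel Lbar) :=
  [set u | exists g : G, extends (val u) (val g)].

Definition ext_orbit (p : Lbar) : set Lbar :=
  [set q | exists2 u, extensions u & (val u) p = q].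

Definition is_orbit (M : set Lbar) : Prop := exists p, M = ext_orbit p.

Definition is_stable (M : set Lbar) : Prop :=
  forall p, M p -> ext_orbit p `<=` M.

(* "There is no orbit M <> C" presupposes that C itself is an orbit, in which
   case M ranges over the orbits here. But an interval-homogeneous C need not
   be an orbit: it may for instance contain points of different cofinalities.
   In that case the images of C under the normalizer of G are no orbits either,
   and M ranges over the unions of orbits. *)
Definition orbit_like (M : set Lbar) : Prop :=
  is_stable M /\ (is_orbit (range (@emb d L)) -> is_orbit M).

Definition full_action (M : set Lbar) : Prop :=
  forall f : Lbar -> Lbar, is_iso M M f <->
    exists2 u, extensions u & forall p, M p -> (val u) p = f p.

Definition full_action_rel (M : set Lbar) : Prop :=
  forall f : Lbar -> Lbar, is_iso M M f \/ is_antiiso M M f <->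
    exists2 u, extensions u & forall p, M p -> (val u) p = f p.

End ActionOnCompletion.

Arguments conjugators {d L P} G _.
Arguments extensions {d L P} G _.
Arguments orbit_like {d L P} G M.
Arguments full_action {d L P} G M.
Arguments full_action_rel {d L P} G M.

(* Main.v *)
(* The automorphisms of L extend to the Dedekind completion K, and 2-interval
   homogeneity produces automorphisms of K with support in any given arc that
   move points freely inside it: an element that expands an arc has fixed
   points on both sides of it, and can be replaced by the identity outside the
   arc between two of them.

   For a group with such elements, Rubin's method recovers the action on K.
   Disjointness of supports has an algebraic counterpart, so an automorphism
   phi of the group sends the elements supported near a point p to elements
   supported near a point s p; compactness of K gives the existence of s p, and
   the density of the local orbits its uniqueness. The bijection s satisfies
   s g s^-1 = phi g. Whether two points of K are separated by two others can
   be read off from the action, so s preserves separation and hence preserves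
   or reverses the orientation. *)

Require Import Defs.
From mathcomp Require Import all_boot all_order.
From mathcomp Require Import boolp classical_sets functions cardinality.
From Stdlib Require Import Lia.

Set Implicit Arguments.
Unset Strict Implicit.
Unset Printing Implicit Defensive.

Import Order.TTheory.

Local Open Scope classical_set_scope.
Local Open Scope card_scope.
Local Open Scope group_scope.

(** * Cyclic orders *)

(** Rubin's criterion recovers disjointness of supports only up to a twelfth power: algebraic
    disjointness of [f] from [g] gives that [g ^+ 12] fixes what [f] moves. Hence every arc must
    carry an element whose twelfth power is nontrivial.

    The fixed points at which an automorphism is cut may be gaps of [L]. The cutting therefore takes
    place in [K], where it keeps the image of [L] stable, and only the result is restricted to [L].

    The reconstruction is stated for an abstract group with an injective [rho] into the
    automorphisms of [K], preserving or reversing, whose image contains the extensions of Aut(C).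
    One argument then serves Aut(C), Aut(C^rel), Aut(K) and Aut(K^rel).

    For part (2), the conjugator [h] of an automorphism carries [C] to a set [M = h(C)] on which the
    group again acts fully. If [M = C], then [h] restricts to an automorphism of [C], possibly
    reversing; otherwise [M] is of the kind that the hypotheses exclude. *)

Section Rank.
Context {d : Order.disp_t} (K : orderType d).

Definition ncyc (x y z : nat) : Prop :=
  (x < y /\ y < z)%coq_nat \/ (y < z /\ z < x)%coq_nat \/ (z < x /\ x < y)%coq_nat.

Fixpoint occurs (x : K) (s : seq K) : Prop :=
  if s is y :: s' then x = y \/ occurs x s' else False.

(** The cyclic order of finitely many points depends only on their relative positions. Counting the
    listed points below [x] turns such statements into linear arithmetic on naturals, which is how
    [cyc_order] hands them to [lia]. *)
Lemma cyc_rank (s : seq K) : exists r : K -> nat,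
  (forall x y z, occurs x s -> occurs y s -> occurs z s ->
     is_true (cyc x y z) = ncyc (r x) (r y) (r z)) /\
  (forall x y, occurs x s -> occurs y s -> (x = y) = (r x = r y)).
Proof.
pose r (x : K) := count (fun y : K => y < x)%O s.
have mono (u v : K) : (u <= v)%O -> (r u <= r v)%N.
  by move=> uv; apply: sub_count => w wu; exact: lt_le_trans uv.
have smono (u v : K) : occurs u s -> (u < v)%O -> (r u < r v)%N.
  rewrite /r => {r mono} us uv; elim: s us => //= w s IH [<-|us].
    rewrite ltxx uv add0n add1n ltnS; apply: sub_count => z /= zu.
    exact: lt_trans uv.
  have lew : ((w < u)%O <= (w < v)%O)%N.
    by case: (boolP (w < u)%O) => // /lt_trans ->.
  by rewrite -addnS; apply: leq_add (IH us).
have ltE u v : occurs u s -> occurs v s -> (u < v)%O = (r u < r v)%N.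
  move=> us vs; apply/idP/idP; first exact: smono.
  by move=> ruv; rewrite ltNge; apply/negP => /mono; rewrite leqNgt ruv.
exists r; split=> [x y z xs ys zs|x y xs ys].
  rewrite /cyc !ltE //; apply/propext; rewrite /ncyc; split.
    case/or3P=> /andP[/ssrnat.ltP ? /ssrnat.ltP ?]; by [left|right; left|right; right].
  by case=> [|[]] [/ssrnat.ltP -> /ssrnat.ltP ->]; rewrite ?orbT.
apply/propext; split=> [->//|rxy].
have [xy|yx|//] := ltgtP x y.
  by have := smono _ _ xs xy; rewrite rxy ltnn.
by have := smono _ _ ys yx; rewrite rxy ltnn.
Qed.

End Rank.

Ltac cyc_add x l :=
  lazymatch l with
  | context[cons x _] => l
  | _ => constr:(cons x l)
  end.
Ltac cyc_points K t l :=
  lazymatch t with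
  | ?A -> ?B => let l' := cyc_points K A l in cyc_points K B l'
  | ?A /\ ?B => let l' := cyc_points K A l in cyc_points K B l'
  | ?A \/ ?B => let l' := cyc_points K A l in cyc_points K B l'
  | ?A <-> ?B => let l' := cyc_points K A l in cyc_points K B l'
  | ~ ?A => cyc_points K A l
  | is_true (@cyc _ K ?x ?y ?z) =>
      let l := cyc_add x l in let l := cyc_add y l in cyc_add z l
  | @eq ?T ?x ?y =>
      let _ := match goal with _ => unify T (Order.Total.sort K) end in
      let l := cyc_add x l in cyc_add y l
  | _ => l
  end.
Ltac cyc_occurs := solve [repeat (first [left; reflexivity | right])].

(* Replaces the points of the goal by their ranks, for lia to decide *)
Ltac cyc_order :=
  unfold reverse_coercion;
  match goal with |- context[@cyc _ ?K _ _ _] =>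
    match goal with |- ?t =>
      let l := cyc_points K t constr:(@nil (Order.Total.sort K)) in
      let r := fresh in let rc := fresh in let re := fresh in
      have [r [rc re]] := @cyc_rank _ K l;
      repeat match goal with
        | |- context[is_true (@cyc _ K ?x ?y ?z)] =>
            rewrite (rc x y z); [|cyc_occurs..]
        | |- context[@eq ?T ?x ?y] =>
            unify T (Order.Total.sort K); rewrite (re x y); [|cyc_occurs..]
        end;
      clear rc re; unfold ncyc;
      repeat match goal with |- context[r ?x] => generalize (r x); intro end;
      lia
    end
  end.

(** * Reconstruction of a locally dense action *)

(** Compact Hausdorff spaces, phrased without open sets. [base_regular] says that base sets are
    regular open: arbitrarily close to a point outside [U], boundary points included, lie base sets
    disjoint from [U]. [base_compact] is compactness as an induction principle for properties that
    pass to subsets and to finite unions. *)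
Record topology_base (T : Type) (B : set (set T)) : Prop := {
  base_neq0 : forall U, B U -> U !=set0;
  base_cover : forall x, exists2 U, B U & U x;
  base_setI : forall U V x, B U -> B V -> U x -> V x ->
    exists W, [/\ B W, W x & W `<=` U `&` V];
  base_hausdorff : forall x y, x <> y ->
    exists U V, [/\ B U, B V, U x, V y & forall z, U z -> ~ V z];
  base_regular : forall U V x, B U -> ~ U x -> B V -> V x ->
    exists W, [/\ B W, W `<=` V & forall z, W z -> ~ U z];
  base_compact : forall P : set T -> Prop,
    (forall U V, U `<=` V -> P V -> P U) ->
    (forall U V, P U -> P V -> P (U `|` V)) ->
    (forall x, exists U, [/\ B U, U x & P U]) -> P [set: T] }.

Definition supported (T : Type) (G : groupType) (a : G -> T -> T) (U : set T) :
  set G := [set g | forall x, ~ U x -> a g x = x].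

(* Below, a point moved by g ^+ 12 has five distinct images under the powers
   of g with exponent at most 4, since 12 is divisible by 1, 2, 3 and 4. *)
Record locally_dense (T : Type) (B : set (set T)) (G : groupType)
    (a : G -> T -> T) : Prop := {
  act_one : forall x, a 1 x = x;
  act_mul : forall g h x, a (g * h) x = a g (a h x);
  act_faithful : forall g, (forall x, a g x = x) -> g = 1;
  act_base : forall g U, B U -> B (a g @` U);
  act_dense : forall U V x, B U -> B V -> V `<=` U -> U x ->
    exists2 g, supported a U g & V (a g x);
  act_exponent : forall U, B U -> exists2 g, supported a U g & g ^+ 12 <> 1 }.

(** * Supports, commutation and Rubin's criterion *)

Section Support.
Context (T : Type) (B : set (set T)) (G : groupType) (a : G -> T -> T).
Hypotheses (hB : topology_base B) (ha : locally_dense B a).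
Implicit Types (g h f k : G) (x y z : T) (U V W : set T).

Let a1 := act_one ha.
Let aM := act_mul ha.

Lemma actK g x : a g^-1 (a g x) = x.
Proof. by rewrite -aM mulVg a1. Qed.

Lemma actVK g x : a g (a g^-1 x) = x.
Proof. by rewrite -aM mulgV a1. Qed.

Lemma act_inj g x y : a g x = a g y -> x = y.
Proof. by move=> e; rewrite -(actK g x) e actK. Qed.

Lemma act_ext g h : (forall x, a g x = a h x) -> g = h.
Proof.
move=> gh; apply: divg1_eq; apply: (act_faithful ha) => x.
by rewrite aM gh actVK.
Qed.

Lemma act_moved g : g <> 1 -> exists x, a g x <> x.
Proof.
move=> g1; apply: contrapT => n; apply/g1/(act_faithful ha) => x.
by apply: contrapT => gx; apply: n; exists x.
Qed.

Lemma supported_sub U V g : U `<=` V -> supported a U g -> supported a V g.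
Proof. by move=> UV gU x nVx; apply: gU => /UV. Qed.

Lemma supported_mem U g x : supported a U g -> a g x <> x -> U x.
Proof. by move=> gU gx; apply: contrapT => /gU. Qed.

Lemma supportedM U g h : supported a U g -> supported a U h ->
  supported a U (g * h).
Proof. by move=> gU hU x nUx; rewrite aM hU // gU. Qed.

Lemma supportedV U g : supported a U g -> supported a U g^-1.
Proof. by move=> gU x nUx; rewrite -{1}(gU _ nUx) actK. Qed.

Lemma supportedX U g n : supported a U g -> supported a U (g ^+ n).
Proof.
move=> gU; elim: n => [|n IH] x nUx; first by rewrite expg0 a1.
by rewrite expgS aM IH // gU.
Qed.

Lemma supportedJ U g h : supported a U g ->
  supported a (a h @` U) (h * g * h^-1).
Proof.
move=> gU x nUx; rewrite !aM gU ?actVK // => Ux; apply: nUx.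
by exists (a h^-1 x) => //; rewrite actVK.
Qed.

Lemma moved_image g x : a g x <> x -> a g (a g x) <> a g x.
Proof. by move=> gx /act_inj. Qed.

Lemma disjoint_commute f g : (forall x, a f x <> x -> a g x = x) ->
  f * g = g * f.
Proof.
move=> fg; apply: act_ext => x; rewrite !aM.
have [fx|fx] := pselect (a f x = x).
  have [gx|gx] := pselect (a g x = x); first by rewrite fx gx.
  rewrite fx; apply: contrapT => /fg ggx.
  exact: (moved_image gx).
by rewrite (fg _ fx) (fg _ (moved_image fx)).
Qed.

Lemma supported_commute U V f g : (forall x, U x -> ~ V x) ->
  supported a U f -> supported a V g -> f * g = g * f.
Proof.
move=> UV fU gV; apply: disjoint_commute => x /(supported_mem fU) /UV.
exact: gV.
Qed.

Lemma base_preim g U x : B U -> U (a g x) ->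
  exists V, [/\ B V, V x & forall y, V y -> U (a g y)].
Proof.
move=> BU Ux; exists (a g^-1 @` U); split; first exact: (act_base ha).
  by exists (a g x) => //; rewrite actK.
by move=> _ [y Uy <-]; rewrite actVK.
Qed.

Lemma base_displace g x : a g x <> x ->
  exists U, [/\ B U, U x & forall y, U y -> ~ U (a g y)].
Proof.
move=> gx; have [U [V [BU BV Ux Vx UV]]] := base_hausdorff hB gx.
have [W [BW Wx WU]] := base_preim BU Ux.
have [X [BX Xx XWV]] := base_setI hB BW BV Wx Vx.
exists X; split=> // y /XWV[/WU Ugy _] /XWV[_].
exact: UV Ugy.
Qed.

Lemma base_displaces (s : seq G) V x : B V -> V x ->
  (forall g, g \in s -> a g x <> x) ->
  exists U, [/\ B U, U x, U `<=` V &
    forall g y, g \in s -> U y -> ~ U (a g y)].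
Proof.
move=> BV Vx; elim: s => [_|g s IH gsx]; first by exists V; split.
have [|U [BU Ux UV Us]] := IH; first by move=> h hs; apply: gsx; rewrite in_cons hs orbT.
have [|W [BW Wx Wg]] := @base_displace g x; first by apply: gsx; rewrite mem_head.
have [X [BX Xx XUW]] := base_setI hB BU BW Ux Wx.
exists X; split=> //; first by move=> y /XUW[/UV].
move=> h y; rewrite in_cons => /orP[/eqP->|hs] /XUW[Uy Wy] /XUW[Ugy Wgy].
  exact: Wg Wgy.
exact: (Us _ _ hs Uy).
Qed.

Lemma base_moved g x : a g x <> x ->
  exists U, [/\ B U, U x & forall y, U y -> a g y <> y].
Proof.
move=> /base_displace[U [BU Ux Ug]]; exists U; split=> // y Uy gy.
by apply: (Ug y) => //; rewrite gy.
Qed.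

Lemma nontrivial_supported U : B U -> exists2 g, supported a U g & g <> 1.
Proof.
move=> /(act_exponent ha)[g gU g12]; exists g => // g1.
by apply: g12; rewrite g1 expg1n.
Qed.

Lemma noncommuting_supported U : B U -> exists f g,
  [/\ supported a U f, supported a U g & f * g <> g * f].
Proof.
move=> BU; have [f fU f1] := nontrivial_supported BU.
have [x fx] := act_moved f1; have Ux := supported_mem fU fx.
have [|V [BV Vx VU Vf]] := @base_displaces [:: f] U x BU Ux.
  by move=> g; rewrite inE => /eqP ->.
have [g gV g1] := nontrivial_supported BV.
exists f, g; split=> //; first exact: supported_sub gV.
have [y gy] := act_moved g1; have Vy := supported_mem gV gy.
move=> fg; apply: gy; apply: (@act_inj f).
rewrite -aM fg aM gV //; apply: Vf => //; exact: mem_head.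
Qed.

Let comm g h := g * h * g^-1 * h^-1.

(* Rubin's algebraic counterpart of disjointness of supports *)
Definition alg_disjoint f g := forall h, f * h <> h * f ->
  exists f1 f2, [/\ f1 * g = g * f1, f2 * g = g * f2,
    comm f1 (comm f2 h) <> 1 &
    comm f1 (comm f2 h) * g = g * comm f1 (comm f2 h)].

(** As [f] and [h] do not commute, some [x] is moved by both. Near [x] there is a [U] that [h]
    carries off itself and on which [g] is trivial. For noncommuting [f1], [f2] supported in [U],
    the commutator of [f2] and [h] is [f2] times an element supported in the image of [U] under [h].
    That factor commutes with [f1], so the double commutator collapses to the commutator of [f1] and
    [f2]. *)
Lemma alg_disjointP f g : (forall x, a f x <> x -> a g x = x) ->
  alg_disjoint f g.
Proof.
move=> fg h fh.
have [x fx hx] : exists2 x, a f x <> x & a h x <> x.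
  apply: contrapT => n; apply/fh/disjoint_commute => x fx.
  by apply: contrapT => hx; apply: n; exists x.
have [V [BV Vx Vf]] := base_moved fx.
have [|U [BU Ux UV Uh]] := @base_displaces [:: h] V x BV Vx.
  by move=> k; rewrite inE => /eqP ->.
have [f1 [f2 [f1U f2U f12]]] := noncommuting_supported BU.
have Ug k : supported a U k -> k * g = g * k.
  move=> kU; apply: disjoint_commute => y /(supported_mem kU) /UV /Vf.
  exact: fg.
have [m mU mE] : exists2 m, supported a (a h @` U) m & comm f2 h = f2 * m.
  exists (h * f2^-1 * h^-1); first exact/supportedJ/supportedV.
  by rewrite /comm !mulgA.
have f1m : f1 * m = m * f1.
  apply: (supported_commute _ f1U mU) => y Uy [z Uz zy].
  by apply: (Uh h z _ Uz); rewrite ?mem_head // zy.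
have kE : comm f1 (comm f2 h) = comm f1 f2.
  have mf1 : m * f1^-1 = f1^-1 * m.
    by apply: (@mulgI _ f1); rewrite !mulgA f1m mulgK mulgV mul1g.
  rewrite mE /comm invgM !mulgA -(mulgA _ m f1^-1) mf1.
  by rewrite !mulgA mulgK.
have kU : supported a U (comm f1 f2).
  have f12U := supportedM f1U f2U.
  have f121U := supportedM f12U (supportedV f1U).
  exact: supportedM f121U (supportedV f2U).
exists f1, f2; rewrite kE; split; [exact: Ug|exact: Ug| |exact: Ug].
move=> k1; apply: f12; rewrite -[LHS](mulgVK (f2 * f1)).
by rewrite invgM !mulgA -/(comm f1 f2) k1 mul1g.
Qed.

Lemma fixedX g x n : a g x = x -> a (g ^+ n) x = x.
Proof.
by move=> gx; elim: n => [|n IH]; rewrite ?expg0 ?a1 // expgS aM IH.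
Qed.

(** Otherwise a small [U] around [x] is carried off itself by [f] and by the first four powers of
    [g]. For a nontrivial [h] supported in [U], the double commutator [k] moves only points of four
    translates of [U], by 1, [f1], [f2] and [f1 * f2]. Since [k] commutes with [g], a point moved by
    [k] has five moved images under the exponents 0 to 4, and two of these lie in the same
    translate. The translating elements commute with [g], so a power of [g] with exponent between 1
    and 4 sends a point of [U] into [U], a contradiction. *)
Lemma alg_disjoint_supp f g x : alg_disjoint f g -> a f x <> x ->
  a (g ^+ 12) x = x.
Proof.
move=> fg fx; apply: contrapT => gx.
have [V [BV Vx _]] := base_moved fx.
have gdvd i : i %| 12 -> a (g ^+ i) x <> x.
  move=> /dvdnP[j j12] gix; apply: gx; rewrite j12 mulnC expgnA.
  exact: fixedX.
have [|U [BU Ux UV Us]] := @base_displaces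
  [:: f; g; g ^+ 2; g ^+ 3; g ^+ 4] V x BV Vx.
  move=> k; rewrite !inE => /or4P[/eqP->|/eqP->|/eqP->|/orP[]/eqP->] //; [|exact: gdvd..].
  exact: (gdvd 1%N).
have [h hU h1] := nontrivial_supported BU.
have [y hy] := act_moved h1; have Uy := supported_mem hU hy.
have fh : f * h <> h * f.
  move=> fh; apply: hy; apply: (@act_inj f).
  rewrite -aM fh aM hU //; apply: Us => //; exact: mem_head.
have [f1 [f2 [f1g f2g]]] := fg _ fh.
set k := comm _ _ => k1 kg.
have k_supp z : a k z <> z -> [\/ U z, U (a f1^-1 z), U (a f2^-1 z) |
    U (a f2^-1 (a f1^-1 z))].
  move=> kz; apply: contrapT => nU; apply: kz.
  have n1 : ~ U z by move=> ?; apply: nU; constructor 1.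
  have n2 : ~ U (a f1^-1 z) by move=> ?; apply: nU; constructor 2.
  have n3 : ~ U (a f2^-1 z) by move=> ?; apply: nU; constructor 3.
  have n4 : ~ U (a f2^-1 (a f1^-1 z)) by move=> ?; apply: nU; constructor 4.
  have hV := supportedV hU.
  rewrite /k /comm !invgM !invgK !aM.
  by rewrite (hV _ n3) actVK hU // hV // hU // !actVK.
have [z0 kz0] := act_moved k1.
have kgj j : a k (a (g ^+ j) z0) <> a (g ^+ j) z0.
  move=> e; apply: kz0; apply: (@act_inj (g ^+ j)).
  rewrite -aM -[RHS]e -aM; congr a.
  exact/esym/(commuteX _ _).
pose m (i : 'I_4) := nth 1 [:: 1; f1^-1; f2^-1; f2^-1 * f1^-1] i.
have gV u : u * g = g * u -> u^-1 * g = g * u^-1.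
  by move=> e; apply: (@mulgI _ u); rewrite !mulgA e mulgV mul1g mulgK.
have mg i : m i * g = g * m i.
  rewrite /m; case: i => -[|[|[|[|//]]]] /= _; rewrite ?mul1g ?mulg1 ?gV //.
  by rewrite -mulgA gV // mulgA gV // mulgA.
have cover (j : 'I_5) : exists i, U (a (m i) (a (g ^+ j) z0)).
  have /k_supp[Uz|Uz|Uz|Uz] := kgj j.
  - by exists (@Ordinal 4 0 isT); rewrite /m /= a1.
  - by exists (@Ordinal 4 1 isT).
  - by exists (@Ordinal 4 2 isT).
  - by exists (@Ordinal 4 3 isT); rewrite /m /= aM.
have [c cP] := choice cover.
have [i [j [ij cij]]] : exists i j : 'I_5, (i < j)%N /\ c i = c j.
  have /injectivePn[i [j ij cij]] : ~~ injectiveb c.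
    by apply/negP => /injectiveP /leq_card; rewrite !card_ord.
  have [lt|lt|/val_inj e] := ltngtP i j.
  - by exists i, j.
  - by exists j, i.
  - by rewrite e eqxx in ij.
have := cP j; rewrite -cij.
have -> : g ^+ j = g ^+ (j - i) * g ^+ i by rewrite -expgnDr subnK // ltnW.
rewrite aM -(aM (m (c i))).
have -> : m (c i) * g ^+ (j - i) = g ^+ (j - i) * m (c i).
  exact: commuteX.
rewrite aM; apply: Us; last exact: cP.
have : (0 < j - i <= 4)%N.
  by rewrite subn_gt0 ij /= leq_subLR (leq_trans _ (leq_addl _ _)) // -ltnS.
case: (j - i)%N => [|[|[|[|[|n]]]]] // _; by rewrite !inE ?eqxx ?orbT.
Qed.

End Support.

(** * The point map induced by an automorphism of the group *)

Section Transport.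
Context (T : Type) (B : set (set T)) (G : groupType) (a : G -> T -> T).
Hypotheses (hB : topology_base B) (ha : locally_dense B a).
Implicit Types (g h f k : G) (x y z p q : T) (U V W A : set T).

Let a1 := act_one ha.
Let aM := act_mul ha.
Let aK := @actK _ _ _ _ ha.
Let aVK := @actVK _ _ _ _ ha.

Definition transport (phi : G -> G) U : set T :=
  [set y | exists2 g, supported a U g & a (phi g) y <> y].

(* Two points correspond when every neighbourhood of one carries an element
   whose image lives near the other. *)
Definition matches (phi : G -> G) p q := forall U A, B U -> B A -> U p -> A q ->
  exists g, [/\ supported a U g, g <> 1 & supported a A (phi g)].

Section Iso.
Context (phi psi : G -> G).
Hypotheses (phiM : {morph phi : g h / g * h})
  (phiK : cancel phi psi) (psiK : cancel psi phi).

Let phi1 : phi 1 = 1.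
Proof. by apply: (@mulgI _ (phi 1)); rewrite -phiM !mulg1. Qed.

Let phiV g : phi g^-1 = (phi g)^-1.
Proof. by apply: (@mulgI _ (phi g)); rewrite -phiM !mulgV phi1. Qed.

Let phiX g n : phi (g ^+ n) = phi g ^+ n.
Proof. by elim: n => [|n IH]; rewrite ?expg0 // !expgS phiM IH. Qed.

Let phi_neq1 g : g <> 1 -> phi g <> 1.
Proof. by move=> g1 e; apply: g1; apply: (can_inj phiK); rewrite e phi1. Qed.

Lemma alg_disjoint_morph f g : alg_disjoint f g -> alg_disjoint (phi f) (phi g).
Proof.
move=> fg h; rewrite -(psiK h); move: (psi h) => {}h fh.
have [|f1 [f2 [f1g f2g k1 kg]]] := fg h.
  by move=> e; apply: fh; rewrite -!phiM e.
exists (phi f1), (phi f2); rewrite -!(phiV, phiM) f1g f2g kg.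
by split=> //; exact: phi_neq1.
Qed.

Lemma transport_sub U V : U `<=` V -> transport phi U `<=` transport phi V.
Proof. by move=> UV x [g gU gx]; exists g => //; exact: supported_sub gU. Qed.

Lemma transport_supp U g : supported a U g ->
  supported a (transport phi U) (phi g).
Proof. by move=> gU x nx; apply: contrapT => gx; apply: nx; exists g. Qed.

Lemma transport_open U x : transport phi U x ->
  exists A, [/\ B A, A x & A `<=` transport phi U].
Proof.
move=> [g gU gx]; have [A [BA Ax Ag]] := base_moved hB ha gx.
by exists A; split=> // y /Ag gy; exists g.
Qed.

Lemma transport_neq0 U : B U -> transport phi U !=set0.
Proof.
move=> BU; have [g gU /phi_neq1 g1] := nontrivial_supported ha BU.
by have [x gx] := act_moved ha g1; exists x, g.
Qed.

(** If [g] moved a point of [V], it would carry a small [W] in [V] off itself. Take [k] supported in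
    [W] with nontrivial twelfth power. It is disjoint from everything supported in [U], so by the
    criterion the twelfth power of [phi k] is trivial on [transport phi U] and commutes with
    [phi g]. Then [g] commutes with [k ^+ 12], which is impossible because [g] displaces [W]. *)
Lemma supported_transport U V g : supported a (transport phi U) (phi g) ->
  B V -> (forall x, V x -> ~ U x) -> forall x, V x -> a g x = x.
Proof.
move=> gU BV VU x Vx; apply: contrapT => gx.
have [|W [BW Wx WV Wg]] := @base_displaces _ _ _ _ hB ha [:: g] V x BV Vx.
  by move=> k; rewrite inE => /eqP ->.
have [k kW k12] := act_exponent ha BW.
have kU : supported a (~` transport phi U) (phi (k ^+ 12)).
  move=> y /contrapT[f fU fy]; rewrite phiX.
  apply: (alg_disjoint_supp hB ha _ fy).
  apply: alg_disjoint_morph; apply: (alg_disjointP hB ha) => z fz; apply: kW.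
  by move=> /WV/VU; apply; exact: supported_mem fz.
have gk : g * k ^+ 12 = k ^+ 12 * g.
  apply: (can_inj phiK); rewrite (phiM g) (phiM _ g).
  apply: (supported_commute ha _ gU kU).
  by move=> y ?; apply.
have [y ky] := act_moved ha k12.
have Wy := supported_mem (@supportedX _ _ _ _ ha _ _ 12 kW) ky.
apply: ky; apply: (@act_inj _ _ _ _ ha g); rewrite -aM gk aM.
by apply: (@supportedX _ _ _ _ ha _ _ 12 kW); apply: Wg => //; rewrite mem_head.
Qed.

(** [supported_transport] only controls [g] on base sets disjoint from [U]. Boundary points of [U]
    are reached through [base_regular]: a neighbourhood moved by [g] would contain such a set. *)
Lemma supported_transportE U g : B U -> supported a (transport phi U) (phi g) ->
  supported a U g.
Proof.
move=> BU gU x nUx; apply: contrapT => gx.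
have [W [BW Wx Wg]] := base_moved hB ha gx.
have [V [BV VW VU]] := base_regular hB BU nUx BW Wx.
have [y Vy] := base_neq0 hB BV.
exact/(Wg _ (VW _ Vy))/(supported_transport gU BV VU).
Qed.

Lemma matches_transport p q : (forall U A, B U -> B A -> U p -> A q ->
  transport phi U `&` A !=set0) -> matches phi p q.
Proof.
move=> pq U A BU BA Up Aq; have [y [Uy Ay]] := pq _ _ BU BA Up Aq.
have [V [BV Vy VU]] := transport_open Uy.
have [W [BW Wy WVA]] := base_setI hB BV BA Vy Ay.
have [g gW g1] := nontrivial_supported ha BW.
exists (psi g); rewrite psiK; split.
- apply: supported_transportE => //; rewrite psiK.
  by apply: supported_sub gW => z /WVA[/VU].
- by move=> e; apply: g1; rewrite -(psiK g) e phi1.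
- by apply: supported_sub gW => z /WVA[].
Qed.

(** If [p] matched nothing, each [q] would have a neighbourhood missed by the transport of some
    neighbourhood of [p]. Shrinking the neighbourhood of [p] keeps this true and handles finite
    unions, so by compactness the transport of some neighbourhood of [p] would be empty. *)
Lemma matches_total p : exists q, matches phi p q.
Proof.
apply: contrapT => nq.
suff [U [BU Up]] : exists U, [/\ B U, U p &
    forall y, [set: T] y -> ~ transport phi U y].
  by have [y Uy] := transport_neq0 BU => /(_ y I).
apply: (base_compact hB
  (P := fun A => exists U, [/\ B U, U p & forall y, A y -> ~ transport phi U y])).
- by move=> A A' AA' [U [BU Up UA]]; exists U; split=> // y /AA' /UA.
- move=> A A' [U [BU Up UA]] [U' [BU' Up' UA']].
  have [V [BV Vp VU]] := base_setI hB BU BU' Up Up'.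
  exists V; split=> // y [/UA|/UA'] n Vy; apply: n;
    by apply: transport_sub Vy => z /VU[].
- move=> q; have /existsNP[U /existsNP[A n]] : ~ forall U A, B U -> B A -> U p ->
      A q -> transport phi U `&` A !=set0.
    by move=> /matches_transport pq; apply: nq; exists q.
  move/not_implyP: n => [BU /not_implyP[BA /not_implyP[Up /not_implyP[Aq n]]]].
  exists A; split=> //; exists U; split=> // y Ay Uy; apply: n; by exists y.
Qed.

Lemma matches_act p q g : matches phi p q -> matches phi (a g p) (a (phi g) q).
Proof.
move=> pq U A BU BA Up Aq.
have BV := act_base ha g^-1 BU; have BC := act_base ha (phi g)^-1 BA.
have [||f [fV f1 fC]] := pq _ _ BV BC.
- by exists (a g p) => //; rewrite aK.
- by exists (a (phi g) q) => //; rewrite aK.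
exists (g * f * g^-1); split.
- move=> x nUx; rewrite !aM fV ?aVK // => -[y Uy yx].
  by apply: nUx; rewrite -(aVK g x) -yx aVK.
- by move=> e; apply: f1; rewrite -(mulKg g f) -[g * f](mulgVK g) e mul1g mulVg.
- move=> x nAx; rewrite !phiM phiV !aM fC ?aVK // => -[y Ay yx].
  by apply: nAx; rewrite -(aVK (phi g) x) -yx aVK.
Qed.

End Iso.

Lemma matches_sym phi psi p q : cancel phi psi ->
  matches phi p q -> cancel psi phi -> {morph phi : g h / g * h} ->
  matches psi q p.
Proof.
move=> phiK pq psiK phiM U A BU BA Uq Ap.
have [g [gA g1 gU]] := pq _ _ BA BU Ap Uq; exists (phi g); rewrite phiK; split=> //.
move=> e; apply: g1; apply: (@mulgI _ (psi 1)); rewrite mulg1.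
by apply: (can_inj phiK); rewrite phiM e mulg1.
Qed.

(** Two distinct matches force [p] outside [transport psi A] for a neighbourhood [A] of [q]. Then
    the matches of [p] spread densely over [A], and some of them come to lie where only elements
    living away from [p] are sent. *)
Lemma matches_functional phi psi p q q' : {morph phi : g h / g * h} ->
  cancel phi psi -> cancel psi phi ->
  matches phi p q -> matches phi p q' -> q = q'.
Proof.
move=> phiM phiK psiK pq pq'; apply: contrapT => /(base_hausdorff hB).
have psiM : {morph psi : g h / g * h}.
  by move=> g h; apply: (can_inj phiK); rewrite phiM !psiK.
move=> [A [A' [BA BA' Aq Aq' AA']]].
(* Otherwise some nontrivial [g] near [p], with [phi g] supported in [A'] because [q'] matches,
   would be supported in [transport psi A]. Then [phi g] would be trivial on [A'] too, since [A'] is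
   disjoint from [A]. *)
have np : ~ transport psi A p.
  move=> Wp; have [U [BU Up UW]] := transport_open Wp.
  have [g [gU g1 gA']] := pq' _ _ BU BA' Up Aq'.
  apply: g1; apply: (can_inj phiK); apply: (act_ext ha) => y.
  have -> : phi 1 = 1 by apply: (@mulgI _ (phi 1)); rewrite -phiM !mulg1.
  rewrite a1; have [A'y|/gA' //] := pselect (A' y).
  apply: (@supported_transport _ _ psiM psiK phiK A _ _ _ BA' _ _ A'y).
    by rewrite phiK; exact: supported_sub gU.
  by move=> z A'z /AA'.
(* By [np], the elements [psi g] with [g] supported in [A] fix [p]. By equivariance [p] then matches
   every image of [q] under such [g], and these images are dense in [A]. *)
have dense C : B C -> C `<=` A -> exists2 r, C r & matches phi p r.
  move=> BC CA; have [g gA Cgq] := act_dense ha BA BC CA Aq.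
  exists (a g q) => //; rewrite -[g]psiK.
  suff pgp : a (psi g) p = p by rewrite -{1}pgp; exact: matches_act.
  exact: transport_supp gA _ np.
have [x Wx] := transport_neq0 psiM psiK BA.
have [|U [V [BU BV Up Vx UV]]] := base_hausdorff hB (x := p) (y := x).
  by move=> px; apply: np; rewrite px.
have [W [BW Wx' WA]] := transport_open Wx.
have [X [BX Xx XVW]] := base_setI hB BV BW Vx Wx'.
have [n nX n1] := nontrivial_supported ha BX.
(* [n] lives away from [p], yet [phi n] is supported in [A]. A match of [p] inside [C] yields a
   nontrivial element near [p] whose image is supported in [transport phi X], which makes that
   element trivial since [U] avoids [X]. *)
have [C [BC CA CX]] : exists C, [/\ B C, C `<=` A & C `<=` transport phi X].
  have [y ny] : exists y, a (phi n) y <> y.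
    apply: act_moved ha _ _ => e; apply: n1; apply: (can_inj phiK).
    by rewrite e; apply: (@mulgI _ (phi 1)); rewrite -phiM !mulg1.
  have [C [BC Cy Cn]] := base_moved hB ha ny.
  have nA : supported a A (phi n).
    apply: (supported_transportE psiM psiK phiK BA); rewrite phiK.
    by apply: supported_sub nX => z /XVW[_ /WA].
  have [D [BD Dy DCA]] := base_setI hB BC BA Cy (supported_mem nA ny).
  exists D; split=> // z /DCA[Cz Az] //.
  by exists n => //; exact: Cn.
have [r Cr pr] := dense _ BC CA.
have [g [gU g1 gC]] := pr _ _ BU BC Up Cr.
apply: g1; apply: (act_faithful ha) => z.
have [Uz|/gU //] := pselect (U z).
apply: (@supported_transport _ _ phiM phiK psiK X _ _ _ BU _ _ Uz).
  exact: supported_sub gC.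
by move=> y /UV Vy /XVW[].
Qed.

Theorem reconstruction phi : bijective phi -> {morph phi : g h / g * h} ->
  exists s : sym T, forall g x, s (a g x) = a (phi g) (s x).
Proof.
move=> [psi phiK psiK] phiM.
have psiM : {morph psi : g h / g * h}.
  by move=> g h; apply: (can_inj phiK); rewrite phiM !psiK.
have [s sP] := choice (matches_total phiM phiK psiK).
have [t tP] := choice (matches_total psiM psiK phiK).
have st : cancel s t.
  move=> p; apply: (matches_functional psiM psiK phiK (tP _)).
  exact: matches_sym phiK (sP p) psiK phiM.
have ts : cancel t s.
  move=> p; apply: (matches_functional phiM phiK psiK (sP _)).
  exact: matches_sym psiK (tP p) phiK psiM.
exists (Sym st ts) => g x /=.
apply: (matches_functional phiM phiK psiK (sP _)).
exact: matches_act.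
Qed.

Lemma base_moving V x : B V -> V x -> exists2 g, supported a V g & a g x <> x.
Proof.
move=> BV Vx; have [y Vy yx] : exists2 y, V y & y <> x.
  have [g gV /(act_moved ha)[y gy]] := nontrivial_supported ha BV.
  have Vy := supported_mem gV gy.
  have [yx|] := pselect (y = x); last by exists y.
  exists (a g x); rewrite -yx //.
  exact/(supported_mem gV)/(moved_image ha gy).
have [C [D [BC BD Cy Dx CD]]] := base_hausdorff hB yx.
have [E [BE Ey EVC]] := base_setI hB BV BC Vy Cy.
have [g gV Egx] := act_dense ha BV BE (fun z Ez => (EVC z Ez).1) Vx.
exists g => // gx; have [_ Cx] := EVC _ Egx.
by apply: (CD x) => //; rewrite -gx.
Qed.

(** The composite of [s] with the inverse of [t] commutes with the whole action. If it moved [x], it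
    would be contradicted by an element that moves [x] and is supported in a neighbourhood of [x]
    avoiding the image of [x]. *)
Lemma intertwiner_unique phi (s t : sym T) :
  (forall g x, s (a g x) = a (phi g) (s x)) ->
  (forall g x, t (a g x) = a (phi g) (t x)) -> s = t.
Proof.
move=> sP tP.
have cP g x : t^-1 (s (a g x)) = a g (t^-1 (s x)).
  by rewrite sP -{1}(symVE t (s x)) -tP; exact: symK.
suff u1 x : t^-1 (s x) = x by apply: sym_eq => x; rewrite -{2}(u1 x) symVE.
apply: contrapT => /(base_hausdorff hB)[U [V [BU BV Uy Vx UV]]].
have [g gV gx] := base_moving BV Vx.
apply: gx; have := cP g x; rewrite [RHS]gV; last exact: UV.
by move=> /(can_inj (@symK _ t^-1))/(can_inj (@symK _ s)).
Qed.

End Transport.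

(** * The topology of a complete circle *)

(** [circle_complete] is Dedekind completeness, one arc at a time: [cyc a x y] orders the open arc
    from [a] to [b] linearly, the trace of [D] on it is a nonempty proper initial segment, and [s]
    is its supremum. No point of the circle is distinguished. *)
Record complete_circle {d : Order.disp_t} (K : orderType d) : Prop := {
  circle_nontrivial : exists a b : K, a <> b;
  circle_dense : forall a b : K, a <> b -> exists x, cyc a x b;
  circle_complete : forall (a b : K) (D : set K),
    (exists2 x, cyc a x b & D x) -> (exists2 x, cyc a x b & ~ D x) ->
    (forall x y, cyc a x y -> cyc a y b -> D y -> D x) ->
    exists s, [/\ cyc a s b, forall x, cyc a x s -> D x &
                  forall x, cyc s x b -> ~ D x] }.

Section ArcTopology.
Context {d : Order.disp_t} (K : orderType d).
Hypothesis hK : complete_circle K.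
Implicit Types (a b c e x y z s : K).

Let dense := circle_dense hK.

Lemma dense_left a c x : a <> x -> c <> x -> exists y, cyc a y x /\ cyc c y x.
Proof.
move=> ax cx; have [y ay] := dense ax; have [z cz] := dense cx.
have [acx|nacx] := pselect (cyc a c x).
  by exists z; move: ax cx ay cz acx; cyc_order.
by exists y; move: ax cx ay cz nacx; cyc_order.
Qed.

Lemma dense_right a c x : a <> x -> c <> x -> exists y, cyc x y a /\ cyc x y c.
Proof.
move=> ax cx; have [y ay] := dense (nesym ax); have [z cz] := dense (nesym cx).
have [xac|nxac] := pselect (cyc x a c).
  by exists y; move: ax cx ay cz xac; cyc_order.
by exists z; move: ax cx ay cz nxac; cyc_order.
Qed.

Lemma arc_base a b : a <> b -> is_cinterval (cinterval a b).
Proof. by exists a, b. Qed.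

(** The arc from a fixed [u] is extended as long as [P] holds for it. At a cut point [s] before the
    return to [u], a good arc around [s] would carry [P] beyond [s]. So [P] holds for all arcs up to
    [u], and a good arc around [u] closes the circle. *)
Lemma arc_compact (P : set K -> Prop) :
  (forall U V, U `<=` V -> P V -> P U) ->
  (forall U V, P U -> P V -> P (U `|` V)) ->
  (forall x, exists U, [/\ is_cinterval U, U x & P U]) -> P [set: K].
Proof.
move=> PS PU Ploc; have [o _] := circle_nontrivial hK.
have [_ [[u [v [_ ->]]] ouv Puv]] := Ploc o.
pose D x := P (cinterval u x).
have Dsub x y : cyc o x y -> cyc o y u -> D y -> D x.
  by move=> oxy oyu; apply: PS => z; rewrite /cinterval /=; move: oxy oyu; cyc_order.
have [t ot] := @dense o v ltac:(by move: ouv; rewrite /cinterval /=; cyc_order).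
have Dt : D t.
  apply: PS Puv => z; rewrite /cinterval /= in ouv *.
  by move: ouv ot; cyc_order.
have tu : cyc o t u by move: ouv ot; rewrite /cinterval /=; cyc_order.
have [all|/existsNP[w /not_implyP[wu nDw]]] := pselect (forall x, cyc o x u -> D x).
  have [_ [[c [e [_ ->]]] cue PW]] := Ploc u.
  rewrite /cinterval /= in cue.
  have [x [ox cx]] := @dense_left o c u
    ltac:(by move: tu; cyc_order) ltac:(by move: cue; cyc_order).
  apply: (PS _ (cinterval u x `|` cinterval c e)); last exact: PU (all _ ox) PW.
  by move=> z _; rewrite /setU /cinterval /=; move: ox cx cue; cyc_order.
have [||//|s [os sD snD]] := @circle_complete _ _ hK o u D.
- by exists t.
- by exists w.
have [_ [[c [e [_ ->]]] cse PW]] := Ploc s.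
rewrite /cinterval /= in cse.
have [x [ox cx]] := @dense_left o c s
  ltac:(by move: os; cyc_order) ltac:(by move: cse; cyc_order).
have [y [uy ey]] := @dense_right u e s
  ltac:(by move: os; cyc_order) ltac:(by move: cse; cyc_order).
case: (snD _ uy); apply: (PS _ (cinterval u x `|` cinterval c e)).
  by move=> z; rewrite /setU /cinterval /=; move: os ox cx uy ey cse; cyc_order.
exact: PU (sD _ ox) PW.
Qed.

Lemma arc_topology : topology_base (@is_cinterval _ K).
Proof.
split.
- move=> _ [a [b [/dense[x abx] ->]]]; by exists x.
- move=> x; have [y yx] : exists y, y <> x.
    have [a [b ab]] := circle_nontrivial hK.
    by have [<-|] := pselect (a = x); [exists b => /esym|exists a].
  have [z xzy] := dense (nesym yx); exists (cinterval y z).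
    by apply: arc_base; move: xzy; cyc_order.
  by rewrite /cinterval /=; move: xzy; cyc_order.
- move=> _ _ x [a [b [_ ->]]] [c [e [_ ->]]]; rewrite /cinterval /= => axb cxe.
  have [l [al cl]] := @dense_left a c x
    ltac:(by move: axb; cyc_order) ltac:(by move: cxe; cyc_order).
  have [r [rb re]] := @dense_right b e x
    ltac:(by move: axb; cyc_order) ltac:(by move: cxe; cyc_order).
  exists (cinterval l r); split.
  + by apply: arc_base; move: axb cxe al cl rb re; cyc_order.
  + by rewrite /cinterval /=; move: axb cxe al cl rb re; cyc_order.
  + by move=> y; rewrite /setI /cinterval /=; move: axb cxe al cl rb re; cyc_order.
- move=> x y xy; have [z xzy] := dense xy; have [w ywx] := dense (nesym xy).
  exists (cinterval w z), (cinterval z w); rewrite /cinterval /=; split.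
  + by apply: arc_base; move: xzy ywx; cyc_order.
  + by apply: arc_base; move: xzy ywx; cyc_order.
  + by move: xzy ywx; cyc_order.
  + by move: xzy ywx; cyc_order.
  + by move=> t; cyc_order.
- move=> U V x [a [b [ab ->]]]; rewrite /cinterval /= => nx [c [e [_ ->]]].
  (* At the right endpoint [b] the exterior of the arc lies just after [x]. At any other outside
     point, [a] included, the points just before [x] are outside. *)
  rewrite /cinterval /= => cxe; have [xb|xb] := pselect (x = b).
    subst x; have [r [ra re]] := @dense_right a e b
      ltac:(by move: ab cxe; cyc_order) ltac:(by move: cxe; cyc_order).
    exists (cinterval b r); split.
    + by apply: arc_base; move: ra; cyc_order.
    + by move=> y; rewrite /cinterval /=; move: cxe ra re; cyc_order.
    + by move=> y; rewrite /cinterval /=; move: ra re; cyc_order.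
  have [l [bl cl]] := @dense_left b c x
    ltac:(by move: xb cxe; cyc_order) ltac:(by move: cxe; cyc_order).
  exists (cinterval l x); split.
  + by apply: arc_base; move: bl; cyc_order.
  + by move=> y; rewrite /cinterval /=; move: cxe bl cl; cyc_order.
  + by move=> y; rewrite /cinterval /=; move: nx xb ab bl; cyc_order.
- exact: arc_compact.
Qed.

End ArcTopology.

(** * Fixed points of maps that expand an arc *)

Section FixedPoint.
Context {d : Order.disp_t} (K : orderType d).
Hypothesis hK : complete_circle K.
Implicit Types (a b c e x y z s : K) (u v : sym K).

Let dense := circle_dense hK.

Lemma orient_preservingE u x y z : u \in @orient_preserving _ K ->
  cyc (u x) (u y) (u z) = cyc x y z.
Proof. by move=> /asboolP. Qed.

(** The hypotheses say that the arc from [p1] to [p2] lies strictly inside its image, the arc from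
    [q1] to [q2]. Along the latter, [u] moves [p1] backwards and [p2] forwards, and the fixed point
    is the supremum of the points moved backwards. *)
Lemma fixed_point u p1 p2 : u \in @orient_preserving _ K ->
  cyc (u p1) p1 p2 -> cyc (u p1) p2 (u p2) ->
  exists2 s, u s = s & cyc p1 s p2.
Proof.
move=> uP; set q1 := u p1; set q2 := u p2 => c1 c2.
have uE x y z : cyc (u x) (u y) (u z) = cyc x y z by exact: orient_preservingE.
pose D x := exists2 y, (y = p1 \/ cyc p1 y p2) /\ cyc (u y) y q2 &
  x = y \/ cyc q1 x y.
have [|||s [qsq sD snD]] := @circle_complete _ _ hK q1 q2 D.
- exists p1; first by move: c1 c2; cyc_order.
  exists p1; [split|]; [by left| |by left].
  by rewrite -/q1; move: c1 c2; cyc_order.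
- exists p2; first by move: c1 c2; cyc_order.
  by move=> [y []]; move: c1 c2; cyc_order.
- move=> x y qxy qyq [z [pz zz] yz]; exists z => //.
  by right; case: yz => [<-//|]; move: qxy; cyc_order.
have Dp1 : D p1.
  exists p1; [split|]; [by left| |by left].
  by rewrite -/q1; move: c1 c2; cyc_order.
have nDp2 : ~ D p2 by move=> [y []]; move: c1 c2; cyc_order.
have p1s : p1 = s \/ cyc q1 p1 s.
  apply: contrapT => n; apply: (snD p1) => //.
  by move: n c1 c2 qsq; cyc_order.
have sp2 : p2 = s \/ cyc q1 s p2.
  apply: contrapT => n; apply/nDp2/sD.
  by move: n c1 c2 qsq; cyc_order.
(* Comparison with the preimage [w] of [s] takes the place of continuity. If [u] moves [s]
   backwards, a point [z] between [s] and [w] is still moved backwards, beyond the supremum. If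
   forwards, a point [z] between [w] and [s] is already sent beyond [s], and so is every later point
   moved backwards. *)
have [w ws] : exists w, u w = s by exists (u^-1 s); rewrite symVE.
suff us : u s = s.
  exists s => //.
  have np1 : s <> p1 by move=> e; move: us c1 c2; rewrite e -/q1; cyc_order.
  have np2 : s <> p2 by move=> e; move: us c1 c2; rewrite e -/q2; cyc_order.
  by move: np1 np2 p1s sp2 c1 c2; cyc_order.
have usq : [\/ u s = q1, u s = q2 | cyc q1 (u s) q2].
  have [->|n1] := pselect (s = p1); first by constructor 1.
  have [->|n2] := pselect (s = p2); first by constructor 2.
  by constructor 3; rewrite uE; move: n1 n2 p1s sp2 c1 c2; cyc_order.
apply: contrapT => nus.
have [lt|gt] : cyc (u s) s q2 \/ cyc q1 s (u s).
  by case: usq nus qsq c1 c2 => [->|->|]; cyc_order.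
- have sw : cyc s w p2 by rewrite -uE ws.
  have [z szw] := @dense s w ltac:(by move: sw; cyc_order).
  have uz : cyc (u s) (u z) s by rewrite -{2}ws uE.
  have szq : cyc s z q2 by move: szw sw sp2 c1 c2 qsq; cyc_order.
  apply: (snD z) => //.
  exists z; last by left.
  split; first by right; move: szw sw p1s sp2 c1 c2; cyc_order.
  by case: usq lt uz szq qsq => [->|->|]; cyc_order.
- have sw : cyc p1 w s by rewrite -uE ws.
  have [z wzs] := @dense w s ltac:(by move: sw; cyc_order).
  have uz : cyc s (u z) (u s) by rewrite -{1}ws uE.
  have [|y [py uy] zy] := sD z; first by move: wzs sw p1s c1 c2 qsq; cyc_order.
  have ys : y = s \/ cyc q1 y s.
    apply: contrapT => n; apply: (snD y).
      by move: n py c1 c2 qsq; cyc_order.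
    by exists y; [split|left].
  have [e|ne] := pselect (y = z).
    by move: uy; rewrite e; case: usq gt uz wzs sw p1s sp2 c1 c2 qsq => [->|->|]; cyc_order.
  have [e|ne'] := pselect (y = s).
    by move: uy; rewrite e; case: usq gt => [->|->|] {}; cyc_order.
  have uzy : cyc (u z) (u y) (u s).
    by rewrite uE; move: zy ys ne ne' wzs sw p1s c1 c2 qsq; cyc_order.
  have {}ys : cyc q1 y s by case: ys.
  by case: usq uzy gt uy ys uz qsq => [->|->|]; cyc_order.
Qed.

End FixedPoint.

(** * Flexible groups of automorphisms *)

Record flexible {d : Order.disp_t} (K : orderType d) (E : set (sym K)) : Prop := {
  flex_orient : forall u, E u -> u \in @orient_preserving _ K;
  flex_one : E 1;
  flex_inv : forall u, E u -> E u^-1;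
  flex_patch : forall u r s, E u -> r <> s -> u r = r -> u s = s ->
    exists v, [/\ E v, forall x, cyc r x s -> v x = u x &
                  forall x, ~ cyc r x s -> v x = x];
  flex_homogeneous : forall a1 b1 a2 b2 c1 e1 c2 e2 : K,
    a1 <> b1 -> a2 <> b2 -> c1 <> e1 -> c2 <> e2 ->
    (forall x, cyc a1 x b1 -> ~ cyc a2 x b2) ->
    (forall x, cyc c1 x e1 -> ~ cyc c2 x e2) ->
    exists u x1 x2, [/\ E u, cyc a1 x1 b1, cyc a2 x2 b2,
      cyc c1 (u x1) e1 & cyc c2 (u x2) e2] }.

Section Flexible.
Context {d : Order.disp_t} (K : orderType d) (E : set (sym K)).
Hypotheses (hK : complete_circle K) (hE : flexible E).
Implicit Types (a b c e x y z s t : K) (u v : sym K).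

Let dense := circle_dense hK.

Lemma flexE u x y z : E u -> cyc (u x) (u y) (u z) = cyc x y z.
Proof. by move=> /(flex_orient hE); exact: orient_preservingE. Qed.

Definition fixes_outside u a b := forall x, ~ cyc a x b -> u x = x.

(** Homogeneity is applied crosswise, so that [a], [p1], [p2], [u p2], [u p1], [b] appear in this
    order. Then [u] expands the arc from [p1] to [p2] around the circle, while its inverse expands
    the arc from [u p2] to [u p1]. This gives fixed points [r] and [s] in these two arcs, and the
    restriction of [u] to the arc from [r] to [s] still sends [p2] to [u p2] and has its support
    inside the arc from [a] to [b]. *)
Lemma flex_move a x1 x2 y1 y2 b :
  cyc a x1 x2 -> cyc a x2 y1 -> cyc a y1 y2 -> cyc a y2 b ->
  exists v p, [/\ E v, fixes_outside v a b, cyc x1 p x2 & cyc y1 (v p) y2].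
Proof.
move=> o1 o2 o3 o4.
have [||||x|x|u [p1 [p2 [Eu p1P p2P q1P q2P]]]] :=
  flex_homogeneous hE (a1 := a) (b1 := x1) (a2 := x1) (b2 := x2)
    (c1 := y2) (e1 := b) (c2 := y1) (e2 := y2).
- by move: o1; cyc_order.
- by move: o1; cyc_order.
- by move: o4; cyc_order.
- by move: o3; cyc_order.
- by move: o1; cyc_order.
- by move: o3 o4; cyc_order.
have [r ur rP] := @fixed_point _ K hK u p1 p2 (flex_orient hE Eu)
  ltac:(by move: o1 o2 o3 o4 p1P p2P q1P q2P; cyc_order)
  ltac:(by move: o1 o2 o3 o4 p1P p2P q1P q2P; cyc_order).
have uK x : u^-1 (u x) = x by exact: symK.
have [||s us sP] := @fixed_point _ K hK u^-1 (u p2) (u p1)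
  (flex_orient hE (flex_inv hE Eu)).
- rewrite !uK.
  by move: o1 o2 o3 o4 p1P p2P q1P q2P; cyc_order.
- rewrite !uK.
  by move: o1 o2 o3 o4 p1P p2P q1P q2P; cyc_order.
have {}us : u s = s by rewrite -{1}us symVE.
have o5 : cyc a p1 p2 by move: o1 p1P p2P; cyc_order.
have o6 : cyc a p2 (u p2) by move: o1 o2 o3 p2P q2P; cyc_order.
have o7 : cyc a (u p2) (u p1) by move: o3 o4 q1P q2P; cyc_order.
have o8 : cyc a (u p1) b by move: o4 q1P; cyc_order.
have [|v [Ev vin vout]] := flex_patch hE Eu _ ur us.
  by move: rP sP o5 o6 o7; cyc_order.
exists v, p2; split => //.
- move=> x nx; apply: vout.
  by move: nx o5 o6 o7 o8 rP sP; cyc_order.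
- by rewrite vin //; move: o5 o6 o7 rP sP; cyc_order.
Qed.

Lemma fixes_outsideV u a b : fixes_outside u a b -> fixes_outside u^-1 a b.
Proof. by move=> ub x /ub {1}<-; exact: symK. Qed.

(** [flex_move] sends some uncontrolled point [p] before [t] beyond [c]. Being monotone on the arc,
    [v] sends [t] even further. *)
Lemma flex_up a b t c : cyc a t b -> cyc a c b ->
  exists v, [/\ E v, fixes_outside v a b & cyc c (v t) b].
Proof.
move=> atb acb.
have [m [cm tm]] := @dense_left _ _ hK c t b
  ltac:(by move: acb; cyc_order) ltac:(by move: atb; cyc_order).
have [y2 mb] := @dense m b ltac:(by move: cm; cyc_order).
have [x2 at_] := @dense a t ltac:(by move: atb; cyc_order).
have [x1 ax] := @dense a x2 ltac:(by move: at_; cyc_order).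
have [||||v [p [Ev vout pP vpP]]] := @flex_move a x1 x2 m y2 b.
- by move: ax at_; cyc_order.
- by move: at_ tm atb; cyc_order.
- by move: mb cm tm acb atb; cyc_order.
- by move: mb cm acb; cyc_order.
exists v; split=> //.
have va : v a = a by apply: vout; cyc_order.
have vb : v b = b by apply: vout; cyc_order.
have v1 : cyc a (v p) (v t).
  by rewrite -va flexE //; move: ax at_ pP; cyc_order.
have v2 : cyc a (v t) b by rewrite -va -vb flexE.
by move: v1 v2 vpP cm tm acb atb mb; cyc_order.
Qed.

Lemma flex_down a b t c : cyc a t b -> cyc a c b ->
  exists v, [/\ E v, fixes_outside v a b & cyc a (v t) c].
Proof.
move=> atb acb; have [v [Ev vout vc]] := flex_up acb atb.
exists v^-1; split; [exact: flex_inv|exact: fixes_outsideV|].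
have va : v a = a by apply: vout; cyc_order.
have vb : v b = b by apply: vout; cyc_order.
have v2 : cyc a (v c) b by rewrite -va -vb flexE.
by rewrite -(flexE _ _ _ Ev) va symVE; move: vc v2 atb; cyc_order.
Qed.

(** A point at or beyond [e] is pushed down with support starting at [c], and a point at or before
    [c] is pushed up with support ending at [e]. The endpoint of the support prevents overshooting
    the target. *)
Lemma flex_between a b c e t : cyc a t b -> cyc a c e -> cyc a e b ->
  exists v, [/\ E v, fixes_outside v a b & cyc c (v t) e].
Proof.
move=> atb ace aeb.
have [cte|ncte] := pselect (cyc c t e).
  by exists 1; split=> //; exact: flex_one.
have [et|net] := pselect (t = e \/ cyc a e t).
  have [||v [Ev vout vt]] := @flex_down c b t e.
  - by move: et atb ace aeb; cyc_order.
  - by move: ace aeb; cyc_order.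
  exists v; split=> // x nx; apply: vout.
  by move: nx ace aeb; cyc_order.
have [||v [Ev vout vt]] := @flex_up a e t c.
- by move: net atb aeb; cyc_order.
- by [].
exists v; split=> // x nx; apply: vout.
by move: nx aeb; cyc_order.
Qed.

Lemma flex_dense a b c e t : cyc a t b -> c <> e ->
  (forall x, cyc c x e -> cyc a x b) ->
  exists v, [/\ E v, fixes_outside v a b & cyc c (v t) e].
Proof.
move=> atb ce sub.
have [m cme] := dense ce.
(* The target arc may share endpoints with the arc from [a] to [b], whereas [flex_between] needs
   strict inclusions. *)
have [c' cc'] := @dense c m ltac:(by move: cme; cyc_order).
have [e' ee'] := @dense m e ltac:(by move: cme; cyc_order).
have na : ~ cyc c a e by move=> /sub; cyc_order.
have nb : ~ cyc c b e by move=> /sub; cyc_order.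
have sm := sub _ cme.
have [||v [Ev vout vt]] := @flex_between a b c' e' t atb.
- by move: na nb sm atb cme cc' ee'; cyc_order.
- by move: na nb sm atb cme cc' ee'; cyc_order.
exists v; split=> //.
by move: vt cme cc' ee'; cyc_order.
Qed.

(** An element that fixes [a] and pushes [t] forward on the arc keeps pushing it forward, so no
    positive power of it is trivial. *)
Lemma flex_exponent a b : a <> b ->
  exists v, [/\ E v, fixes_outside v a b & v ^+ 12 <> 1].
Proof.
move=> /dense[t atb]; have [v [Ev vout vt]] := flex_up atb atb.
have va : v a = a by apply: vout; cyc_order.
exists v; split=> // v12.
suff vn n : cyc a t (iter n.+1 v t).
  have := vn 11%N; have -> : iter 12 v t = (v ^+ 12) t by [].
  by rewrite v12 -[(1 : sym K) t]/t; cyc_order.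
have vt' : cyc a t (v t) by move: vt atb; cyc_order.
elim: n => // n IH; rewrite iterS.
have : cyc a (v t) (v (iter n.+1 v t)) by rewrite -va flexE.
by move: vt'; cyc_order.
Qed.

End Flexible.

(** * Separation and orientation *)

Section Orientation.
Context {d : Order.disp_t} (K : orderType d).
Hypothesis hK : complete_circle K.
Implicit Types (a b c p q r x y z : K) (u v : sym K).

Let dense := circle_dense hK.

Lemma autrelE u : autrel_pred u ->
  (forall x y z, cyc (u x) (u y) (u z) = cyc x y z) \/
  (forall x y z, cyc (u z) (u y) (u x) = cyc x y z).
Proof. by move=> /orP[] /asboolP; [left|right]. Qed.

Lemma arc_avoid (s : seq K) a b : a <> b -> exists2 x, cyc a x b & x \notin s.
Proof.
elim: s a b => [|h s IH] a b ab; first by have [x] := dense ab; exists x.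
have [ahb|nahb] := pselect (cyc a h b).
  have [|x ax xs] := IH a h; first by move: ahb; cyc_order.
  exists x; first by move: ax ahb; cyc_order.
  have xh : x <> h by move: ax; cyc_order.
  by rewrite in_cons negb_or xs andbT; apply/eqP.
have [x ax xs] := IH a b ab; exists x => //.
rewrite in_cons negb_or xs andbT; apply/eqP => xh.
by apply: nahb; rewrite -xh.
Qed.

Definition distinct x y z := [/\ x <> y, y <> z & z <> x].

Lemma cyc_rot x y z : cyc x y z = cyc y z x.
Proof. by apply/idP/idP; cyc_order. Qed.

Lemma cyc_swap x y z : distinct x y z -> cyc x z y = ~~ cyc x y z.
Proof.
move=> [xy yz zx]; apply/idP/idP; last first.
  by move=> /negP; move: xy yz zx; cyc_order.
by move=> c; apply/negP; move: xy yz zx c; cyc_order.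
Qed.

Lemma cyc_distinct x y z : cyc x y z -> distinct x y z.
Proof. by move=> c; split=> e; move: c; rewrite e; cyc_order. Qed.

(* The side relations of four points determine whether s acts in the same way
   on the orientation of two triples that share two points. *)
Lemma autrel_of_sides (s : sym K) :
  (forall p q x y, p <> q -> x <> p -> x <> q -> y <> p -> y <> q ->
     (cyc p x q == cyc p y q) = (cyc (s p) (s x) (s q) == cyc (s p) (s y) (s q))) ->
  autrel_pred s.
Proof.
move=> side.
have sI x y z : distinct x y z -> distinct (s x) (s y) (s z).
  by move=> [xy yz zx]; split=> /(can_inj (@symK _ s)).
pose keeps x y z := cyc (s x) (s y) (s z) = cyc x y z.
have rot x y z : keeps x y z -> keeps z x y 
  by rewrite /keeps (cyc_rot z) (cyc_rot (s z)).
have step w x y z : distinct x y z -> w <> x -> w <> y -> keeps x y z -> keeps x y w.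
  move=> D wx wy k; have [xy yz zx] := D.
  have D' : distinct x y w by split=> //; exact: nesym.
  have := side x y z w xy zx (nesym yz) wx wy; move: k; rewrite /keeps.
  rewrite (cyc_swap D) (cyc_swap D') (cyc_swap (sI _ _ _ D)) (cyc_swap (sI _ _ _ D')).
  by move=> ->; case: (cyc x y z); case: (cyc x y w); case: (cyc (s x) _ _).
(* Any two triples are joined by exchanging one point at a time. The fresh points [p] and [q] keep
   all intermediate triples distinct, even when the two given triples overlap. *)
have all x y z x' y' z' : distinct x y z -> distinct x' y' z' ->
    keeps x y z -> keeps x' y' z'.
  move=> [xy yz zx] [xy' yz' zx'] k.
  have [p _ ps] := @arc_avoid [:: x; y; z; x'; y'; z'] x y xy.
  have [q _ qs] := @arc_avoid [:: p; x; y; z; x'; y'; z'] x y xy.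
  move: ps qs; rewrite !inE !negb_or => /and5P[/eqP ? /eqP ? /eqP ? /eqP ? /andP[/eqP ? /eqP ?]].
  move=> /andP[/eqP ? /and5P[/eqP ? /eqP ? /eqP ? /eqP ? /andP[/eqP ? /eqP ?]]].
  have k1 : keeps x y p by apply: step k.
  have k2 : keeps p x q.
    by apply: step (rot _ _ _ k1); [split|..] => //; exact: nesym.
  have k3 : keeps q p y'.
    by apply: step (rot _ _ _ k2); [split|..] => //; exact: nesym.
  have k4 : keeps y' q x'.
    by apply: step (rot _ _ _ k3); [split|..] => //; exact: nesym.
  by apply: step (rot _ _ _ k4); [split|..] => //; exact: nesym.
have [[x [y [z [xyz k]]]]|n] := pselect (exists x y z, distinct x y z /\ keeps x y z).
  apply/orP; left; apply/asboolP => x' y' z'; apply/idP/idP => c.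
    have D : distinct x' y' z' by split=> e; move: c; rewrite e; cyc_order.
    by rewrite -(all _ _ _ _ _ _ xyz D k).
  by rewrite (all _ _ _ _ _ _ xyz (cyc_distinct c) k).
have nk x y z : distinct x y z -> cyc (s x) (s y) (s z) = ~~ cyc x y z.
  move=> D; have : ~ keeps x y z by move=> k; apply: n; exists x, y, z.
  by rewrite /keeps; case: (cyc (s x) _ _); case: (cyc x y z).
have swap (u v w : K) : distinct u v w -> cyc w v u = ~~ cyc u v w.
  by move=> D; rewrite cyc_rot cyc_rot cyc_swap.
apply/orP; right; apply/asboolP => x y z.
have [D|nD] := pselect (distinct x y z).
  by rewrite swap ?nk ?negbK //; exact: sI.
apply/idP/idP => /cyc_distinct D; case: nD => //.
by case: D => zy yx xz; split=> e; [apply: yx|apply: zy|apply: xz]; rewrite e.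
Qed.

End Orientation.

(** * Groups of automorphisms that contain a flexible set *)

Section CircleAction.
Context {d : Order.disp_t} (K : orderType d) (E : set (sym K)).
Hypotheses (hK : complete_circle K) (hE : flexible E).
Context (G : groupType) (rho : G -> sym K).
Hypotheses (rhoM : {morph rho : g h / g * h}) (rhoI : injective rho)
  (rho_rel : forall g, autrel_pred (rho g)) (rhoE : E `<=` range rho).
Implicit Types (a b c p q r x y z : K) (u v s : sym K) (g h k : G).

Let act g x := rho g x.

Let rho1 : rho 1 = 1.
Proof. by apply: (@mulgI _ (rho 1)); rewrite -rhoM !mulg1. Qed.

Let rhoX g n : rho (g ^+ n) = rho g ^+ n.
Proof. by elim: n => [|n IH]; rewrite ?expg0 // !expgS rhoM IH. Qed.

Let flex_rho u : E u -> exists g, rho g = u.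
Proof. by move=> /rhoE[g _ <-]; exists g. Qed.

(** All local elements come from [E], whose members are images of group elements. An
    orientation-reversing group element still maps arcs to arcs, with their endpoints exchanged. *)
Lemma circle_action : locally_dense (@is_cinterval _ K) act.
Proof.
split.
- by move=> x; rewrite /act rho1.
- by move=> g h x; rewrite /act rhoM.
- by move=> g g1; apply: rhoI; rewrite rho1; apply: sym_eq.
- move=> g _ [a [b [ab ->]]].
  have gab : rho g a <> rho g b by move=> /(can_inj (@symK _ (rho g))).
  have [gP|gP] := autrelE (rho_rel g).
    exists (rho g a), (rho g b); split=> //; apply/seteqP; split=> [_ [x ax <-]|x].
      by rewrite /cinterval /= /act gP.
    rewrite /cinterval /= -{1}(symVE (rho g) x) gP => ax.
    by exists ((rho g)^-1 x) => //; rewrite /act symVE.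
  exists (rho g b), (rho g a); split=> [|]; first exact: nesym.
  apply/seteqP; split=> [_ [x ax <-]|x].
    by rewrite /cinterval /= /act gP.
  rewrite /cinterval /= -{1}(symVE (rho g) x) gP => ax.
  by exists ((rho g)^-1 x) => //; rewrite /act symVE.
- move=> _ _ x [a [b [ab ->]]] [c [e [ce ->]]] sub axb.
  have [v [/flex_rho[g gv] vout vx]] := flex_dense hK hE axb ce sub.
  by exists g; rewrite /act ?gv // => y /vout; rewrite /act gv.
- move=> _ [a [b [/(flex_exponent hK hE)[v [/flex_rho[g gv] vout v12]] ->]]].
  exists g; first by move=> y /vout; rewrite /act gv.
  by move=> e; apply: v12; rewrite -gv -rhoX e.
Qed.

Lemma cyc_flip a b x : x <> a -> x <> b -> a <> b -> ~~ cyc a x b = cyc b x a.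
Proof.
move=> xa xb ab; apply/idP/idP => [/negP|] c; [|apply/negP];
  move: xa xb ab c; cyc_order.
Qed.

(* If x and y lie on the same side, some g fixing p, q and a third point moves x
   next to y; conversely, an element fixing three points preserves both sides. *)
Lemma same_side p q x y : p <> q -> x <> p -> x <> q -> y <> p -> y <> q ->
  cyc p x q = cyc p y q <->
  (forall k, act k y <> y -> exists g r, [/\ r <> p, r <> q,
     [/\ act g p = p, act g q = q & act g r = r] & act k (act g x) <> act g x]).
Proof.
have hB := arc_topology hK; have ha := circle_action.
move=> pq xp xq yp yq; split.
  move=> side k ky.
  (* The arc with endpoints [p] and [q] that contains both [x] and [y], traversed in its own
     direction. The opposite arc supplies the third fixed point [r]. *)
  have [a [b [ab [axb ayb] [pab qab]]]] : exists a b, [/\ a <> b,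
      cyc a x b /\ cyc a y b & (p = a \/ p = b) /\ (q = a \/ q = b)].
    have [c|nc] := boolP (cyc p x q).
      by exists p, q; rewrite -side c; split; auto.
    have nc' : ~~ cyc p y q by rewrite -side.
    by exists q, p; rewrite -(cyc_flip xp xq pq) -(cyc_flip yp yq pq); split; auto.
  have [U [BU Uy Uk]] := base_moved hB ha ky.
  have [W [BW Wy WU]] := base_setI hB BU (arc_base ab) Uy ayb.
  have [g gU Wgx] := act_dense ha (arc_base ab) BW (fun z Wz => (WU z Wz).2) axb.
  have [r rP] := circle_dense hK (nesym ab).
  have out z : ~ cyc a z b -> act g z = z by exact: gU.
  exists g, r; split; [| |split|].
  - by case: pab => ->; move: rP; cyc_order.
  - by case: qab => ->; move: rP; cyc_order.
  - by apply: out; case: pab => ->; cyc_order.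
  - by apply: out; case: qab => ->; cyc_order.
  - by apply: out; move: rP; cyc_order.
  - by apply: Uk; have [] := WU _ Wgx.
move=> H; apply: contrapT => side.
have {side} [a [b [ab axb bya pqab]]] : exists a b, [/\ a <> b, cyc a x b,
   cyc b y a & (a = p /\ b = q) \/ (a = q /\ b = p)].
  have [c|nc] := boolP (cyc p x q).
    exists p, q; split=> //; last by left.
    by rewrite -cyc_flip //; apply/negP => c'; apply: side; rewrite c c'.
  exists q, p; split; [exact: nesym|by rewrite -cyc_flip| |by right].
  by apply: contrapT => /negP/negPf c'; apply: side; rewrite c' (negPf nc).
have [k kU ky] := base_moving hB ha (arc_base (nesym ab)) bya.
have [g [r [rp rq [gp gq gr]]]] := H k ky; apply; apply: kU.
have [ga gb] : rho g a = a /\ rho g b = b by case: pqab => -[-> ->].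
have [ra rb] : r <> a /\ r <> b by case: pqab => -[-> ->].
have [gP|gP] := autrelE (rho_rel g).
  have := gP a x b; rewrite ga gb axb /cinterval /= -/(act g x).
  by move=> c1; move: (c1 : is_true (cyc a (act g x) b)); cyc_order.
(* A reversing element may fix [p] and [q] and exchange the two sides, but it cannot fix three
   distinct points. This is what the fixed point [r] rules out. *)
have e := gP a b r; rewrite ga gb [rho g r]gr in e.
have e' : cyc r b a <-> cyc a b r by rewrite e.
by move: e' ra rb ab; rewrite /cinterval /=; cyc_order.
Qed.

(** The right-hand side of [same_side] mentions only the action, and [s] intertwines the action with
    its twist by [phi]. Sides are therefore preserved by [s], and [autrel_of_sides] applies. *)
Theorem aut_conjugation (phi : G -> G) : is_aut phi ->
  exists2 s : sym K, autrel_pred s &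
    forall g, s * rho g * s^-1 = rho (phi g).
Proof.
move=> [phi_bij phiM].
have [s sP] := reconstruction (arc_topology hK) circle_action phi_bij phiM.
have {}sP g x : s (rho g x) = rho (phi g) (s x) by exact: sP.
have [psi phiK psiK] := phi_bij.
exists s; last by move=> g; apply: sym_eq => x; rewrite !symME sP symVE.
have sI x y : s x = s y -> x = y by exact: (can_inj (@symK _ s)).
apply: (autrel_of_sides hK) => p q x y pq xp xq yp yq.
suff H : cyc p x q = cyc p y q <-> cyc (s p) (s x) (s q) = cyc (s p) (s y) (s q).
  by apply/eqP/eqP => /H.
rewrite !same_side //; try by move=> /sI.
split=> H k ky.
  have [|g [r [rp rq [gp gq gr] kg]]] := H (psi k).
    by move=> e; apply: ky; rewrite /act -{1}(psiK k) -sP; congr (s _).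
  exists (phi g), (s r); rewrite /act -!sP; split; try by move=> /sI.
    by split; congr (s _).
  by rewrite -{1}(psiK k) -sP => /sI.
have [|g [r [rp rq [gp gq gr] kg]]] := H (phi k).
  by rewrite /act -sP => /sI.
exists (psi g), (s^-1 r); rewrite /act; split.
- by move=> e; apply: rp; rewrite -e symVE.
- by move=> e; apply: rq; rewrite -e symVE.
- by split; apply: sI; rewrite sP psiK ?symVE.
- move=> e; apply: kg; rewrite /act -{1 2}(psiK g) -!sP.
  by congr (s _).
Qed.

Lemma conjugator_unique (phi : G -> G) s t :
  (forall g, s * rho g * s^-1 = rho (phi g)) ->
  (forall g, t * rho g * t^-1 = rho (phi g)) -> s = t.
Proof.
move=> sP tP; apply: (intertwiner_unique (arc_topology hK) circle_action (phi := phi)).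
  by move=> g x; rewrite /act -sP !symME [s^-1 _](@symK _ s).
by move=> g x; rewrite /act -tP !symME [t^-1 _](@symK _ t).
Qed.

End CircleAction.

(** * The completion of a circle *)

Section CompletionOrder.
Context {d : Order.disp_t} (L : orderType d).
Local Notation K := (completion L).
Implicit Types (x y z : L) (p q r s : K).

Lemma le_cut p q : (p <= q)%O <-> cut p `<=` cut q.
Proof. by split=> /asboolP. Qed.

Lemma cut_down p x y : cut p y -> (x <= y)%O -> cut p x.
Proof.
have [<- _] := cutP p => py xy u pu.
exact: le_trans xy (py u pu).
Qed.

Lemma emb_le_cut p x : (emb x <= p)%O <-> cut p x.
Proof.
split=> [/le_cut|px]; first by apply; rewrite /= lexx.
by apply/le_cut => y; exact: cut_down.
Qed.

Lemma le_emb x y : (emb x <= emb y)%O = (x <= y)%O.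
Proof. by apply/idP/idP => [/emb_le_cut|xy] //; apply/emb_le_cut. Qed.

Lemma lt_emb x y : (emb x < emb y)%O = (x < y)%O.
Proof. by rewrite !ltNge le_emb. Qed.

Lemma emb_inj : injective (@emb d L).
Proof. by move=> x y e; apply/eqP; rewrite eq_le -!le_emb e lexx. Qed.

Lemma cyc_emb x y z : cyc (emb x) (emb y) (emb z) = cyc x y z.
Proof. by rewrite /cyc !lt_emb. Qed.

Lemma emb_dense p q : dense_order L -> (p < q)%O ->
  exists x, (p < emb x < q)%O.
Proof.
move=> dL pq.
have [y qy npy] : exists2 y, cut q y & ~ cut p y.
  apply: contrapT => n; move: pq; rewrite ltNge => /negP; apply.
  by apply/le_cut => y qy; apply: contrapT => npy; apply: n; exists y.
have py : (p < emb y)%O by rewrite ltNge; apply/negP => /emb_le_cut.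
have : (emb y <= q)%O by apply/emb_le_cut.
(* If [q] is the cut of [y] itself, [y] is not strictly below [q]. As [y] lies outside the closed
   cut [p], there is an upper bound [v] of [p] below [y], and density of [L] gives a point between
   them. *)
rewrite le_eqVlt => /orP[/eqP yq|yq]; last by exists y; rewrite py.
have [v pv vy] : exists2 v, ubound (cut p) v & (v < y)%O.
  apply: contrapT => n; apply: npy; have [<- _] := cutP p => v pv.
  by rewrite leNgt; apply/negP => vy; apply: n; exists v.
have [x /andP[vx xy]] := dL _ _ vy; exists x; rewrite -yq lt_emb xy andbT.
rewrite ltNge; apply/negP => /emb_le_cut /pv.
by rewrite leNgt vx.
Qed.

Lemma completion_sup (S : set K) b : S !=set0 -> (forall p, S p -> (p <= b)%O) ->
  exists s, (forall p, S p -> (p <= s)%O) /\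
            (forall t, (forall p, S p -> (p <= t)%O) -> (s <= t)%O).
Proof.
move=> [p0 Sp0] Sb.
pose A := [set x | exists2 p, S p & cut p x].
(* If no cut in [S] has an element, [S] contains only the adjoined empty cut, which is its own
   supremum. *)
have [[x Ax]|nA] := pselect (A !=set0); last first.
  exists p0; split=> [p Sp|t]; last exact.
  by apply/le_cut => x px; case: nA; exists x, p.
have [_ [[_ [u ub]]|[b0 _]]] := cutP b; last first.
  have [p Sp px] := Ax.
  by have /le_cut/(_ _ px) := Sb _ Sp; rewrite b0.
have Au : ubound A u by move=> y [p /Sb/le_cut pb /pb]; exact: ub.
have Acut : is_cut (lbound (ubound A)).
  split; last first.
    left; split; first by exists x => v; exact.
    by exists u => y; exact.
  apply/seteqP; split=> y yl v vA; last exact: vA.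
  by apply: yl => w; exact.
exists (Completion Acut); split=> [p Sp|t tS].
  by apply/le_cut => y py /= v; apply; exists p.
apply/le_cut => y /= yl; have [<- _] := cutP t => v tv.
by apply: yl => z [p /tS/le_cut pt /pt]; exact: tv.
Qed.

Lemma completion_endpoint :
  exists e : K, (forall p, (e <= p)%O) \/ (forall p, (p <= e)%O).
Proof.
have [[x [xmin|xmax]]|n] := pselect (exists x : L, endpoint x).
- exists (emb x); left => p; apply/emb_le_cut.
  have [_ [[[y py] _]|[_ []]]] := cutP p; first exact: cut_down (xmin y).
  by exists x; left.
- by exists (emb x); right => p; apply/le_cut => y _; exact: xmax.
have c0 : is_cut (@set0 L).
  split; last by right.
  apply/seteqP; split=> // x /= xl; case: n; exists x; left => y.
  by apply: xl.
by exists (Completion c0); left => p; apply/le_cut.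
Qed.

End CompletionOrder.

Section CompletionCircle.
Context {d : Order.disp_t} (L : orderType d).
Hypotheses (hL : is_circle L) (L2 : exists x y : L, x <> y).
Local Notation K := (completion L).
Implicit Types p q r s : K.

Let dL := hL.1.
Let eL := hL.2.

(** An arc from [p] to a smaller [q] passes through infinity. If it contained no point of [L], then
    [L] would have both a greatest and a least element. These coincide for a circle, contrary to
    [L2]. *)
Lemma emb_cyc_dense p q : p <> q -> exists x, cyc p (emb x) q.
Proof.
move=> pq; have [lt|gt|//] := ltgtP p q.
  by have [x xP] := emb_dense dL lt; exists x; rewrite /cyc xP.
have [[x xP]|n] := pselect (exists x, (p < emb x)%O \/ (emb x < q)%O).
  by exists x; rewrite /cyc; case: xP => ->; rewrite gt ?orbT.
have px x : (emb x <= p)%O by rewrite leNgt; apply/negP => ?; apply: n; exists x; left.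
have qx x : (q <= emb x)%O by rewrite leNgt; apply/negP => ?; apply: n; exists x; right.
have [x [y xy]] := L2.
have [m mmax] : exists m : L, forall z, (z <= m)%O.
  have [_ [[_ [m pm]]|[p0 _]]] := cutP p; last first.
    by have /emb_le_cut := px x; rewrite p0.
  by exists m => z; apply: pm; apply/emb_le_cut.
have [_ [[[l ql] _]|[_ []]]] := cutP q; last by exists m; right.
have lmin z : (l <= z)%O by have /le_cut/(_ _ ql) := qx z.
have lm : l = m by apply: eL; [left|right].
have zm z : z = m by apply/eqP; rewrite eq_le mmax -{1}lm lmin.
by case: xy; rewrite (zm x) (zm y).
Qed.

Lemma cyc_lt (a b x : K) : (a < b)%O -> cyc a x b = (a < x < b)%O.
Proof. by move=> ab; rewrite /cyc (lt_gtF ab) !andbF !orbF. Qed.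

Lemma cyc_gt (a b x : K) : (b < a)%O -> cyc a x b = (a < x)%O || (x < b)%O.
Proof.
by move=> ba; rewrite /cyc ba; case: (a < x)%O; case: (x < b)%O.
Qed.

(** When [b < a], the arc consists of the points above [a] followed by those below [b]. The supremum
    is taken in whichever piece the initial segment [D] ends. *)
Lemma completion_circle : complete_circle K.
Proof.
split.
- by have [x [y xy]] := L2; exists (emb x), (emb y) => /emb_inj.
- by move=> a b /emb_cyc_dense[x abx]; exists (emb x).
move=> a b D [x0 ax0 Dx0] [y0 ay0 nDy0] down.
have ab : a <> b by move: ax0; cyc_order.
have sup (S : set K) t : S !=set0 -> (forall p, S p -> (p <= t)%O) ->
    exists s, [/\ forall p, S p -> (p <= s)%O, (s <= t)%O &
      forall x, (x < s)%O -> exists2 p, S p & (x < p)%O].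
  move=> S0 St; have [s [sS sl]] := completion_sup S0 St.
  exists s; split=> // [|x xs]; first exact: sl.
  apply: contrapT => n; move: xs; rewrite ltNge => /negP; apply; apply: sl => p Sp.
  by rewrite leNgt; apply/negP => xp; apply: n; exists p.
have [lt|gt|//] := ltgtP a b.
  have ax0' := ax0; have ay0' := ay0.
  rewrite cyc_lt // in ax0'; rewrite cyc_lt // in ay0'.
  have [/andP[ax0l x0b] /andP[ay0l y0b]] := (ax0', ay0').
  have [||s [sS st xs]] := sup [set x | (a < x < b)%O /\ D x] y0.
  - by exists x0.
  - move=> p [/andP[ap pb] Dp]; rewrite leNgt; apply/negP => y0p; apply: nDy0.
    by apply: (down _ p); rewrite ?cyc_lt ?ap ?pb // ay0l.
  have sb := le_lt_trans st y0b.
  have as_ := lt_le_trans ax0l (sS _ (conj ax0' Dx0)).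
  exists s; split; first by rewrite cyc_lt // as_.
    move=> x; rewrite cyc_lt // => /andP[ax /xs[p [/andP[ap pb] Dp] xp]].
    by apply: (down _ p); rewrite ?cyc_lt ?ax ?ap.
  move=> x; rewrite cyc_lt // => /andP[sx xb] Dx.
  have xP : (a < x < b)%O by rewrite (lt_trans as_).
  by have := sS _ (conj xP Dx); rewrite leNgt sx.
have cE x : cyc a x b = (a < x)%O || (x < b)%O by exact: cyc_gt.
have downl x y : (x < y)%O -> (y < b)%O -> D y -> D x.
  move=> xy yb; apply: down; last by rewrite cE yb orbT.
  by rewrite cyc_gt ?xy ?orbT // (lt_trans yb).
have downr x y : (a < x)%O -> (x < y)%O -> D y -> D x.
  move=> ax xy; apply: down; last by rewrite cE (lt_trans ax).
  by rewrite cyc_lt ?ax // (lt_trans ax).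
have downlr x y : (a < x)%O -> (y < b)%O -> D y -> D x.
  move=> ax yb; apply: down; last by rewrite cE yb orbT.
  by rewrite cyc_gt ?ax // (lt_trans yb).
have [[x1 Dx1 x1b]|nx1] := pselect (exists2 x, D x & (x < b)%O).
  have y0b : (y0 < b)%O.
    by move: ay0; rewrite cE => /orP[ay|//]; case: nDy0; exact: downlr Dx1.
  have [||s [sS st xs]] := sup [set x | (x < b)%O /\ D x] y0.
  - by exists x1.
  - move=> p [pb Dp]; rewrite leNgt; apply/negP => y0p; apply: nDy0.
    exact: downl Dp.
  have sb := le_lt_trans st y0b.
  exists s; split; first by rewrite cE sb orbT.
    move=> x; rewrite cyc_gt ?(lt_trans sb) // => /orP[ax|/xs[p [pb Dp] xp]].
      exact: downlr Dx1.
    exact: downl Dp.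
  move=> x; rewrite cyc_lt // => /andP[sx xb] Dx.
  by have := sS _ (conj xb Dx); rewrite leNgt sx.
have nD x : (x < b)%O -> ~ D x by move=> xb Dx; apply: nx1; exists x.
have ax0l : (a < x0)%O by move: ax0; rewrite cE => /orP[//|/nD].
have [[y1 nDy1 ay1]|ny1] := pselect (exists2 y, ~ D y & (a < y)%O).
  have [||s [sS st xs]] := sup [set x | (a < x)%O /\ D x] y1.
  - by exists x0.
  - move=> p [ap Dp]; rewrite leNgt; apply/negP => y1p; apply: nDy1.
    exact: downr Dp.
  have as_ := lt_le_trans ax0l (sS _ (conj ax0l Dx0)).
  exists s; split; first by rewrite cE as_.
    move=> x; rewrite cyc_lt // => /andP[ax /xs[p [ap Dp] xp]].
    exact: downr Dp.
  move=> x; rewrite cyc_gt ?(lt_trans gt) // => /orP[sx|/nD //] Dx.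
  by have := sS _ (conj (lt_trans as_ sx) Dx); rewrite leNgt sx.
have aD x : (a < x)%O -> D x.
  by move=> ax; apply: contrapT => nDx; apply: ny1; exists x.
have y0b : (y0 < b)%O by move: ay0; rewrite cE => /orP[/aD|].
(* [D] now fills exactly the piece above [a], so the cut is at infinity. The endpoint of the
   completion, least or greatest, is the required point. *)
have [e [emin|emax]] := completion_endpoint L.
  have eb : (e < b)%O by exact: le_lt_trans (emin _) y0b.
  exists e; split; first by rewrite cE eb orbT.
    move=> x; rewrite cyc_gt ?(lt_trans eb) // => /orP[/aD //|].
    by rewrite ltNge emin.
  by move=> x; rewrite cyc_lt // => /andP[_ /nD].
have ae : (a < e)%O by exact: lt_le_trans ax0l (emax _).
exists e; split; first by rewrite cE ae.
  by move=> x; rewrite cyc_lt // => /andP[/aD].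
move=> x; rewrite cyc_gt ?(lt_trans gt) // => /orP[|/nD //].
by rewrite ltNge emax.
Qed.

End CompletionCircle.

(** * Extension of automorphisms to the completion *)

(** The flag [o] allows preserving and reversing automorphisms to be extended by one argument: the
    target order is reversed when [o] is false. *)
Definition ocyc {d : Order.disp_t} (K : orderType d) (o : bool) (x y z : K) :=
  if o then cyc x y z else cyc z y x.

Lemma circle_ocomplete {d : Order.disp_t} (K : orderType d) o (a b : K) (D : set K) :
  complete_circle K ->
  (exists2 x, ocyc o a x b & D x) -> (exists2 x, ocyc o a x b & ~ D x) ->
  (forall x y, ocyc o a x y -> ocyc o a y b -> D y -> D x) ->
  exists s, [/\ ocyc o a s b, forall x, ocyc o a x s -> D x &
                forall x, ocyc o s x b -> ~ D x].
Proof.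
move=> hK; case: o => /=; first exact: circle_complete.
move=> [x0 ax0 Dx0] [y0 ay0 nDy0] down.
(* Reading the arc backwards turns an initial segment into a final one, whose complement is
   initial. *)
have [|||s [bs sD snD]] := @circle_complete _ _ hK b a (~` D).
- by exists y0.
- by exists x0 => //; apply.
- move=> x y bxy bya nDy Dx; apply/nDy/(down _ x) => //.
    by move: bxy bya; cyc_order.
  by move: bxy bya; cyc_order.
by exists s; split=> // x /snD /contrapT.
Qed.

Section Extension.
Context {d : Order.disp_t} (L : orderType d).
Hypotheses (hL : is_circle L) (L2 : exists x y : L, x <> y).
Local Notation K := (completion L).
Let hK : complete_circle K := completion_circle hL L2.
Implicit Types (g : sym L) (o : bool).

Ltac ocyc_order o := rewrite /ocyc; case: (o); cyc_order.

Definition preserves g o := forall x y z, ocyc o (g x) (g y) (g z) = cyc x y z.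

Lemma preservesV g o : preserves g o -> preserves g^-1 o.
Proof.
case: o => gP x y z.
  by have := gP (g^-1 x) (g^-1 y) (g^-1 z); rewrite /= !symVE => ->.
by have := gP (g^-1 z) (g^-1 y) (g^-1 x); rewrite /= !symVE => ->.
Qed.

(** The graph of the extension of [g] to the completion, given as a relation: [q] lies in the image
    of every arc around [p] with endpoints in [L]. The lemmas below show that it is total and
    functional. *)
Definition extends_at g o (p q : K) := forall x y,
  cyc (emb x) p (emb y) -> ocyc o (emb (g x)) q (emb (g y)).

Section Orient.
Context (g : sym L) (o : bool).
Hypothesis gP : preserves g o.
Let V := extends_at g o.

Let gE x y z :
  ocyc o (emb (g x)) (emb (g y)) (emb (g z)) = cyc (emb x) (emb y) (emb z).
Proof. by rewrite cyc_emb -gP /ocyc; case: (o); rewrite cyc_emb. Qed.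

Let odense (p q : K) : p <> q -> exists z, ocyc o p (emb (g z)) q.
Proof.
move=> pq; suff [z zP] : exists z, ocyc o p (emb z) q.
  by exists (g^-1 z); rewrite symVE.
by rewrite /ocyc; case: (o); apply: (emb_cyc_dense hL L2) => //; exact: nesym.
Qed.

Lemma extends_at_emb x : V (emb x) (emb (g x)).
Proof. by move=> y z; rewrite gE. Qed.

Lemma extends_at_emb_unique x q : V (emb x) q -> q = emb (g x).
Proof.
move=> Vq; apply: contrapT => nq.
have [z zP] := odense (nesym nq); have [w wP] := odense nq.
have : ocyc o (emb (g w)) (emb (g x)) (emb (g z)).
  by move: zP wP; ocyc_order o.
by rewrite gE => /Vq; move: zP wP; ocyc_order o.
Qed.

Lemma extends_at_sym p q : V p q -> forall x y,
  ocyc o (emb (g x)) q (emb (g y)) -> cyc (emb x) p (emb y).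
Proof.
move=> Vpq x y xqy; apply: contrapT => n.
have px : p <> emb x.
  move=> px; move: Vpq; rewrite px => /extends_at_emb_unique qx.
  by move: xqy; rewrite qx; ocyc_order o.
have py : p <> emb y.
  move=> py; move: Vpq; rewrite py => /extends_at_emb_unique qy.
  by move: xqy; rewrite qy; ocyc_order o.
have xy : emb x <> emb y.
  by move=> /emb_inj xy; move: xqy; rewrite xy; ocyc_order o.
have : cyc (emb y) p (emb x) by move: n px py xy; cyc_order.
by move=> /Vpq; move: xqy; ocyc_order o.
Qed.

Lemma extends_at_functional p q q' : V p q -> V p q' -> q = q'.
Proof.
move=> Vq Vq'; apply: contrapT => qq'.
have [z zP] := odense qq'; have [w wP] := odense (nesym qq').
have : cyc (emb w) p (emb z).
  by apply: (extends_at_sym Vq); move: zP wP; ocyc_order o.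
have : cyc (emb z) p (emb w).
  by apply: (extends_at_sym Vq'); move: zP wP; ocyc_order o.
by cyc_order.
Qed.

(** Points of [L] chosen in the three gaps enclose [p], [q] and [r] in disjoint arcs, and [g]
    respects the order of these arcs. *)
Lemma extends_at_cyc p q r p' q' r' : V p p' -> V q q' -> V r r' ->
  cyc p q r -> ocyc o p' q' r'.
Proof.
move=> Vp Vq Vr pqr.
have [x pxq] := @emb_cyc_dense _ _ hL L2 p q ltac:(by move: pqr; cyc_order).
have [y qyr] := @emb_cyc_dense _ _ hL L2 q r ltac:(by move: pqr; cyc_order).
have [z rzp] := @emb_cyc_dense _ _ hL L2 r p ltac:(by move: pqr; cyc_order).
have zpx : cyc (emb z) p (emb x) by move: pqr pxq qyr rzp; cyc_order.
have xqy : cyc (emb x) q (emb y) by move: pqr pxq qyr rzp; cyc_order.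
have yrz : cyc (emb y) r (emb z) by move: pqr pxq qyr rzp; cyc_order.
have xyz : cyc (emb x) (emb y) (emb z) by move: pqr pxq qyr rzp; cyc_order.
rewrite -gE in xyz.
by move: xyz (Vp _ _ zpx) (Vq _ _ xqy) (Vr _ _ yrz); ocyc_order o.
Qed.

Lemma extends_at_total p : exists q, V p q.
Proof.
have [[x ->]|np] := pselect (exists x, p = emb x).
  by exists (emb (g x)); exact: extends_at_emb.
have {}np x : p <> emb x by move=> px; apply: np; exists x.
have [a _] := L2.
have [b pba] := emb_cyc_dense hL L2 (np a).
(* The initial segment generated by the images of the points of [L] between [a] and [p]. Its cut
   point is the value at [p]. *)
pose D (y : K) := exists2 x, cyc (emb a) (emb x) p &
  y = emb (g x) \/ ocyc o (emb (g a)) y (emb (g x)).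
have [x0 ax0] := emb_cyc_dense hL L2 (nesym (np a)).
have [z0 pz0] := emb_cyc_dense hL L2 (np b).
have gax x : cyc (emb a) (emb x) p -> ocyc o (emb (g a)) (emb (g x)) (emb (g b)).
  by rewrite gE; move: pba; cyc_order.
have below x z : cyc (emb a) (emb x) p -> cyc p (emb z) (emb b) ->
    ocyc o (emb (g a)) (emb (g x)) (emb (g z)).
  by rewrite gE; move: pba; cyc_order.
have nD z : cyc p (emb z) (emb b) -> ~ D (emb (g z)).
  move=> pzb [x axp xz]; have := below _ _ axp pzb.
  by case: xz => [->|]; ocyc_order o.
have [|||s [os sD snD]] :=
  @circle_ocomplete _ _ o (emb (g a)) (emb (g b)) D hK.
- exists (emb (g x0)); first exact: gax.
  by exists x0 => //; left.
- exists (emb (g z0)); last exact: nD.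
  by rewrite gE; move: pba pz0; cyc_order.
- move=> y y' ayy' ay'b [x axp xy']; exists x => //; right.
  by case: xy' ayy' => [->//|]; ocyc_order o.
(* Strictness holds because [p] is not in the image of [L]: there is a further point [x'] of [L]
   between [x] and [p]. The same applies on the other side in [hi]. *)
have lo x : cyc (emb a) (emb x) p -> ocyc o (emb (g a)) (emb (g x)) s.
  move=> axp; have [x' xx'] := emb_cyc_dense hL L2 (nesym (np x)).
  have ax' : cyc (emb a) (emb x') p by move: axp xx'; cyc_order.
  have : ocyc o (emb (g a)) (emb (g x)) (emb (g x')).
    by rewrite gE; move: axp xx'; cyc_order.
  have : ~ ocyc o s (emb (g x')) (emb (g b)).
    by move=> /snD; apply; exists x' => //; left.
  by have := gax _ ax'; move: os; ocyc_order o.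
have hi z : cyc p (emb z) (emb b) -> ocyc o s (emb (g z)) (emb (g b)).
  move=> pzb; have [z' zz'] := emb_cyc_dense hL L2 (np z).
  have pz' : cyc p (emb z') (emb b) by move: pzb zz'; cyc_order.
  have : ocyc o (emb (g z')) (emb (g z)) (emb (g b)).
    by rewrite gE; move: pzb zz'; cyc_order.
  have : ocyc o (emb (g a)) (emb (g z')) (emb (g b)).
    by rewrite gE; move: pba pz'; cyc_order.
  have : ~ ocyc o (emb (g a)) (emb (g z')) s by move=> /sD; exact: nD.
  by move: os; ocyc_order o.
exists s => x y xpy.
(* [lo] and [hi] only concern points between [a] and [b], while the given arc around [p] may reach
   beyond them. It is first shrunk to an arc from [x'] to [y']. *)
have [x' ax' xx'] : exists2 x', cyc (emb a) (emb x') p & x = x' \/ cyc (emb x) (emb x') p.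
  have [c|c] := pselect (cyc (emb a) (emb x) p); first by exists x; auto.
  exists x0 => //.
  have [->|xx0] := pselect (x = x0); [by left|right].
  have exx0 : emb x <> emb x0 by move=> /emb_inj.
  by move: c xpy exx0 ax0; cyc_order.
have [y' py' yy'] : exists2 y', cyc p (emb y') (emb b) & y = y' \/ cyc p (emb y') (emb y).
  have [c|c] := pselect (cyc p (emb y) (emb b)); first by exists y; auto.
  exists z0 => //.
  have [->|yz0] := pselect (y = z0); [by left|right].
  have eyz0 : emb y <> emb z0 by move=> /emb_inj.
  by move: c xpy eyz0 pz0; cyc_order.
have c1 : x = x' \/ ocyc o (emb (g x)) (emb (g x')) (emb (g y')).
  case: xx' => [|xx']; [by left|right]; rewrite gE.
  case: yy' xx' => [<-|]; first by move: xpy; cyc_order.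
  by move: xpy; cyc_order.
have c2 : y = y' \/ ocyc o (emb (g x)) (emb (g y')) (emb (g y)).
  case: yy' => [|yy']; [by left|right]; rewrite gE.
  by move: xpy yy'; cyc_order.
have c3 : ocyc o (emb (g x')) s (emb (g y')).
  by move: (lo _ ax') (hi _ py') os; ocyc_order o.
by case: c1 c2 c3 => [->|c1] [->|c2]; move=> // c3; move: c3;
  try move: c1; try move: c2; ocyc_order o.
Qed.

Lemma extends_at_inv p q : V p q -> extends_at g^-1 o q p.
Proof.
move=> Vpq x y; have Vqp := extends_at_sym Vpq.
rewrite -{1}(symVE g x) -{1}(symVE g y); move: Vqp; rewrite /ocyc.
by case: (o) => Vqp; exact: Vqp.
Qed.

End Orient.

Lemma orient_extension g o : preserves g o -> exists2 v : sym K,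
  forall x, v (emb x) = emb (g x) & forall p q r, ocyc o (v p) (v q) (v r) = cyc p q r.
Proof.
move=> gP; have gVP := preservesV gP.
have [s sP] := choice (extends_at_total gP).
have [t tP] := choice (extends_at_total gVP).
have st : cancel s t.
  by move=> p; apply: (extends_at_functional gVP (tP _)); exact: extends_at_inv.
have ts : cancel t s.
  move=> p; apply: (extends_at_functional gP (sP _)).
  have := extends_at_inv gVP (tP p).
  have -> // : g^-1^-1 = g by exact: invgK.
have smono p q r : cyc p q r -> ocyc o (s p) (s q) (s r).
  exact: extends_at_cyc.
exists (Sym st ts) => [x|p q r] /=; first exact: extends_at_emb_unique.
apply/idP/idP => [c|]; last exact: smono.
have ne p' q' : s p' <> s q' -> p' <> q' by move=> n e; apply: n; rewrite e.
have pq : p <> q by apply: ne; move: c; ocyc_order o.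
have qr : q <> r by apply: ne; move: c; ocyc_order o.
have rp : r <> p by apply: ne; move: c; ocyc_order o.
apply: contrapT => n; have : cyc r q p by move: n pq qr rp; cyc_order.
by move=> /smono; move: c; ocyc_order o.
Qed.

End Extension.

Section CompletionExtension.
Context {d : Order.disp_t} (L : orderType d).
Hypothesis hL : is_circle L.
Local Notation K := (completion L).

Lemma completion_subsingleton : (forall x y : L, x = y) -> forall p q : K, p = q.
Proof.
move=> L1; suff n (p q : K) : ~ (p < q)%O.
  by move=> p q; have [/n|/n|] := ltgtP p q.
move=> pq; have [x /andP[px _]] := emb_dense hL.1 pq.
have [y /andP[_ yx]] := emb_dense hL.1 px.
by move: yx; rewrite (L1 y x) ltxx.
Qed.

(** [is_circle] admits orders with at most one point. Their completion has at most one point as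
    well, so that all permutations of it agree. *)
Lemma nontrivial_or_trivial : (exists x y : L, x <> y) \/ (forall p q : K, p = q).
Proof.
have [|n] := pselect (exists x y : L, x <> y); [by left|right].
apply: completion_subsingleton => x y; apply: contrapT => xy.
by apply: n; exists x, y.
Qed.

(** Extension is made a total function on permutations, so that [ext] needs no proof argument.
    Nothing is claimed about its values outside [autrel_pred]. *)
Lemma ext_exists : exists ext : sym L -> sym K, forall g, autrel_pred g ->
  [/\ forall x, ext g (emb x) = emb (g x), autrel_pred (ext g) &
      g \in @orient_preserving _ L -> ext g \in @orient_preserving _ K].
Proof.
suff H g : exists v : sym K, autrel_pred g ->
  [/\ forall x, v (emb x) = emb (g x), autrel_pred v &
      g \in @orient_preserving _ L -> v \in @orient_preserving _ K].
  by have [ext extP] := choice H; exists ext.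
have [L2|K1] := nontrivial_or_trivial; last first.
  exists 1 => _; split=> // [|_]; first by apply/orP; left; apply/asboolP.
  by apply/asboolP.
have [gP|gP] := boolP (g \in @orient_preserving _ L).
  have [v vE vP] := orient_extension hL L2 (asboolW gP : preserves g true).
  by exists v => _; split=> // [|_]; [apply/orP; left|]; apply/asboolP.
have [gR|gR] := boolP (g \in @orient_reversing _ L); last first.
  by exists 1 => /orP[/(negP gP)|/(negP gR)].
have gR' : preserves g false by move=> x y z; exact: (asboolW gR).
have [v vE vP] := orient_extension hL L2 gR'.
exists v => _; split=> //.
by apply/orP; right; apply/asboolP => x y z; exact: vP.
Qed.

Definition ext : sym L -> sym K := sval (cid ext_exists).

Lemma ext_emb g x : autrel_pred g -> ext g (emb x) = emb (g x).
Proof. by move=> gP; have [] := svalP (cid ext_exists) g gP. Qed.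

Lemma ext_autrel g : autrel_pred g -> autrel_pred (ext g).
Proof. by move=> gP; have [] := svalP (cid ext_exists) g gP. Qed.

Lemma ext_aut g : aut_pred g -> aut_pred (ext g).
Proof.
move=> gP; have [|_ _] := svalP (cid ext_exists) g; last exact.
by apply/orP; left.
Qed.

(** The quotient [w] of the two maps fixes [L] pointwise. If it moved [p], points [x] and [y] of [L]
    on the two arcs between [p] and [w p] would separate them, which excludes the preserving case. A
    reversing map cannot fix three points. *)
Lemma ext_unique (u v : sym K) : autrel_pred u -> autrel_pred v ->
  (forall x, u (emb x) = v (emb x)) -> u = v.
Proof.
move=> uP vP uv; have [L2|K1] := nontrivial_or_trivial; last by apply: sym_eq.
have dense := emb_cyc_dense hL L2.
have [wP wE] : autrel_pred (v^-1 * u) /\ forall x, (v^-1 * u) (emb x) = emb x.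
  split; last by move=> x; rewrite symME uv [v^-1 _](@symK _ v).
  have AC := autrel_group_closed K.
  by apply: (group_closedM AC) => //; exact: (group_closedV AC).
suff w1 p : (v^-1 * u) p = p.
  by apply: sym_eq => p; rewrite -{2}(w1 p) symME symVE.
set w := v^-1 * u in wP wE *; apply: contrapT => wp.
have [x xP] := dense _ _ wp; have [y yP] := dense _ _ (nesym wp).
have [z zP] : exists z, cyc (emb y) (emb z) (emb x).
  by apply: dense; move: xP yP; cyc_order.
have [wC|wC] := autrelE wP.
  have := wC (emb x) p (emb y); rewrite !wE.
  move: (w p) xP yP => p' xP yP e.
  have : cyc (emb x) p' (emb y) <-> cyc (emb x) p (emb y) by rewrite e.
  by move: xP yP; cyc_order.
have : cyc (emb x) (emb z) (emb y) <-> cyc (emb y) (emb z) (emb x).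
  by rewrite -(wC (emb y)) !wE.
by move: xP yP zP; cyc_order.
Qed.

End CompletionExtension.

(** * Flexibility from 2-interval homogeneity *)

Section Homogeneous.
Context {d : Order.disp_t} (L : orderType d).
Hypothesis hL : is_circle L.
Local Notation K := (completion L).
Local Notation ext := (ext hL).
Implicit Types (g : sym L) (u v : sym K).

Definition stabilizes_emb (u : sym K) :=
  forall p, range (@emb d L) (u p) <-> range (@emb d L) p.

Lemma ext_stabilizes g : autrel_pred g -> stabilizes_emb (ext g).
Proof.
move=> gP p; split=> [[y _ yp]|[x _ <-]]; last by exists (g x); rewrite ?ext_emb.
exists (g^-1 y) => //; apply: (can_inj (@symK _ (ext g))).
by rewrite ext_emb // symVE.
Qed.

Lemma restriction u : autrel_pred u -> stabilizes_emb u ->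
  exists g, [/\ autrel_pred g, ext g = u & aut_pred u -> aut_pred g].
Proof.
move=> uP uS.
have /choice[f fP] x : exists y, emb y = u (emb x).
  by have [y _ yE] := (uS (emb x)).2 (ex_intro2 _ _ x I erefl); exists y.
have /choice[h hP] x : exists y, emb y = u^-1 (emb x).
  have [|y _ yE] := (uS (u^-1 (emb x))).1; last by exists y.
  by rewrite symVE; exists x.
have fK : cancel f h.
  by move=> x; apply: emb_inj; rewrite hP fP; exact: symK.
have hK : cancel h f.
  by move=> x; apply: emb_inj; rewrite fP hP symVE.
pose g := Sym fK hK.
have gE x : emb (g x) = u (emb x) by exact: fP.
have gaut : aut_pred u -> aut_pred g.
  move=> /asboolP uC; apply/asboolP => x y z.
  by rewrite -[RHS]cyc_emb -[LHS]cyc_emb !gE uC.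
have gP : autrel_pred g.
  move: uP => /orP[/gaut gA|/asboolP uC]; apply/orP; first by left.
  by right; apply/asboolP => x y z; rewrite -[RHS]cyc_emb -[LHS]cyc_emb !gE uC.
exists g; split=> //; apply: (ext_unique hL) => //; first exact: ext_autrel.
by move=> x; rewrite ext_emb.
Qed.

(** These are the extensions of the elements of Aut(C), by [ext_stabilizes] and [restriction].
    Stated inside [K], the condition visibly survives patching with the identity at fixed points
    that need not belong to [L]. *)
Definition ext_aut_set : set (sym K) :=
  [set u | u \in @orient_preserving _ K /\ stabilizes_emb u].

Section Patch.
Context (u : sym K) (r s : K).
Hypotheses (uP : u \in @orient_preserving _ K) (ur : u r = r) (us : u s = s).

Definition patch_fun (w : sym K) p := if cyc r p s then w p else p.

Lemma fixed_arc (w : sym K) : w \in @orient_preserving _ K -> w r = r -> w s = s ->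
  forall p, cyc r (w p) s = cyc r p s.
Proof. by move=> wP wr ws p; rewrite -{1}wr -{1}ws orient_preservingE. Qed.

Lemma patch_funK (w w' : sym K) : cancel w w' -> w \in @orient_preserving _ K ->
  w r = r -> w s = s -> cancel (patch_fun w) (patch_fun w').
Proof.
move=> wK wP wr ws p; rewrite /patch_fun; case: (boolP (cyc r p s)) => c.
  by rewrite fixed_arc // c wK.
by rewrite (negPf c).
Qed.

Lemma patch_fun_cyc p q t : cyc p q t ->
  cyc (patch_fun u p) (patch_fun u q) (patch_fun u t).
Proof.
have uE x y z : cyc x y z -> cyc (u x) (u y) (u z) by rewrite orient_preservingE.
have in3 x : cyc r x s -> cyc r (u x) s by move=> /uE; rewrite ur us.
have in2 x y : cyc r x y -> cyc r (u x) (u y) by move=> /uE; rewrite ur.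
rewrite /patch_fun.
case: (boolP (cyc r p s)) => [cp|/negP cp]; case: (boolP (cyc r q s)) => [cq|/negP cq];
  case: (boolP (cyc r t s)) => [ct|/negP ct] c.
- exact: uE.
- have e : cyc r p q by move: cp cq ct c; cyc_order.
  by move: cp cq ct c (in3 _ cp) (in3 _ cq) (in2 _ _ e); cyc_order.
- have e : cyc r t p by move: cp cq ct c; cyc_order.
  by move: cp cq ct c (in3 _ cp) (in3 _ ct) (in2 _ _ e); cyc_order.
- by move: cp cq ct c (in3 _ cp); cyc_order.
- have e : cyc r q t by move: cp cq ct c; cyc_order.
  by move: cp cq ct c (in3 _ cq) (in3 _ ct) (in2 _ _ e); cyc_order.
- by move: cp cq ct c (in3 _ cq); cyc_order.
- by move: cp cq ct c (in3 _ ct); cyc_order.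
- exact: c.
Qed.

End Patch.

Lemma orient_preservingV u : u \in @orient_preserving _ K ->
  u^-1 \in @orient_preserving _ K.
Proof. exact: group_closedV (aut_group_closed K) u. Qed.

Lemma orient_preserving_homo u :
  (forall p q t, cyc p q t -> cyc (u p) (u q) (u t)) ->
  (forall p q t, cyc p q t -> cyc (u^-1 p) (u^-1 q) (u^-1 t)) ->
  u \in @orient_preserving _ K.
Proof.
move=> uP uVP; apply/asboolP => p q t; apply/idP/idP; last exact: uP.
by move=> /uVP; rewrite ![u^-1 _](@symK _ u).
Qed.

(** Since [L] is dense in its completion, the four arcs may be shrunk to arcs with endpoints in [L],
    which remain disjoint. The hypothesis then applies to the corresponding intervals of [L]. *)
Lemma ext_aut_flexible : (exists x y : L, x <> y) -> interval_homogeneous L 2 ->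
  flexible ext_aut_set.
Proof.
move=> L2 hom; split.
- by move=> u [].
- by split=> //; apply/asboolP.
- move=> u [uP uS]; split; first exact: orient_preservingV.
  by move=> p; rewrite -(uS (u^-1 p)) symVE.
- move=> u r s [uP uS] rs ur us.
  have uVP := orient_preservingV uP.
  have [uVr uVs] : u^-1 r = r /\ u^-1 s = s.
    by split; [rewrite -{1}ur|rewrite -{1}us]; exact: symK.
  pose v := Sym (@patch_funK r s u u^-1 (symK u) uP ur us)
    (@patch_funK r s u^-1 u (symVK u) uVP uVr uVs).
  exists v; split.
  + split; last by move=> p; rewrite /= /patch_fun; case: ifP => _; [exact: uS|split].
    by apply: orient_preserving_homo => p q t; 
      [exact: patch_fun_cyc|exact: (patch_fun_cyc uVP)].
  + by move=> x c; rewrite /= /patch_fun c.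
  + by move=> x /negP/negPf c; rewrite /= /patch_fun c.
move=> a1 b1 a2 b2 c1 e1 c2 e2 /(emb_cyc_dense hL L2)[x1 x1P]
  /(emb_cyc_dense hL L2)[x2 x2P] /(emb_cyc_dense hL L2)[y1 y1P]
  /(emb_cyc_dense hL L2)[y2 y2P] dis dis'.
have sub (a b : K) x : cyc a (emb x) b -> exists z, x <> z /\
    forall t, cyc x t z -> cyc a (emb t) b.
  move=> axb; have xb : emb x <> b by move: axb; cyc_order.
  have [z xz] := emb_cyc_dense hL L2 xb; exists z; split.
    by move=> e; move: xz; rewrite e; cyc_order.
  by move=> t; rewrite -cyc_emb; move: axb xz; cyc_order.
have [x1' [xx1 s1]] := sub _ _ _ x1P; have [x2' [xx2 s2]] := sub _ _ _ x2P.
have [y1' [yy1 t1]] := sub _ _ _ y1P; have [y2' [yy2 t2]] := sub _ _ _ y2P.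
pose I (i : 'I_2) := if i == ord0 then cinterval x1 x1' else cinterval x2 x2'.
pose J (i : 'I_2) := if i == ord0 then cinterval y1 y1' else cinterval y2 y2'.
have I2 (i : 'I_2) : i = ord0 \/ i = ord_max.
  by case: i => -[|[|//]] h; [left|right]; exact/val_inj.
have [||||g gIJ] := hom I J.
- by move=> i; rewrite /I; case: ifP => _; [exists x1, x1'|exists x2, x2'].
- by move=> i; rewrite /J; case: ifP => _; [exists y1, y1'|exists y2, y2'].
- rewrite /Crs /= => i j; rewrite /I; case: (I2 i) (I2 j) => -> [] -> // _;
    apply/seteqP; split=> // z [/=].
  + by move=> /s1/dis n /s2.
  + by move=> /s2 n /s1/dis.
- rewrite /Crs /= => i j; rewrite /J; case: (I2 i) (I2 j) => -> [] -> // _;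
    apply/seteqP; split=> // z [/=].
  + by move=> /t1/dis' n /t2.
  + by move=> /t2 n /t1/dis'.
have [_ [[z1 /= Iz1 <-] Jz1]] := gIJ ord0.
have [_ [[z2 /= Iz2 <-] Jz2]] := gIJ ord_max.
have gP : autrel_pred (val g) by apply/orP; left; exact: (valP g).
exists (ext (val g)), (emb z1), (emb z2); split.
- by split; [exact: (ext_aut _ (valP g))|exact: ext_stabilizes].
- exact: s1.
- exact: s2.
- by rewrite ext_emb //; exact: t1.
- by rewrite ext_emb //; exact: t2.
Qed.

End Homogeneous.

(** * High interval homogeneity *)

Section HighHomogeneity.
Context {d : Order.disp_t} (L : orderType d).
Hypotheses (hL : is_circle L) (hom : interval_homogeneous L 2).
Local Notation K := (completion L).

(** The hypothesis handles pairs of disjoint intervals, so each of the two intervals is first cut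
    into two disjoint pieces. *)
Lemma interval_homogeneous1 : interval_homogeneous L 1.
Proof.
move=> I J hI hJ _ _.
have L2 : exists x y : L, x <> y by have [x [y [xy _]]] := hI ord0; exists x, y.
have split2 (X : set L) : is_cinterval X -> exists Y Z : set L,
    [/\ is_cinterval Y, is_cinterval Z, Y `&` Z = set0 & Y `<=` X].
  move=> [x [y [xy ->]]].
  have exy : emb x <> emb y by move/emb_inj.
  have [z] := emb_cyc_dense hL L2 exy; rewrite cyc_emb => xzy.
  exists (cinterval x z), (cinterval z y); split.
  - by exists x, z; split=> //; move: xzy; cyc_order.
  - by exists z, y; split=> //; move: xzy; cyc_order.
  - by apply/seteqP; split=> // t; rewrite /setI /cinterval /=; move: xzy; cyc_order.
  - by move=> t; rewrite /cinterval /=; move: xzy; cyc_order.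
have [Y [Z [hY hZ YZ YI]]] := split2 _ (hI ord0).
have [Y' [Z' [hY' hZ' YZ' YJ]]] := split2 _ (hJ ord0).
have I2 (i : 'I_2) : i = ord0 \/ i = ord_max.
  by case: i => -[|[|//]] h; [left|right]; exact/val_inj.
have [||||g gYZ] := hom (I := fun i => if i == ord0 then Y else Z)
  (J := fun i => if i == ord0 then Y' else Z').
- by move=> i; case: ifP.
- by move=> i; case: ifP.
- by move=> i j; case: (I2 i) (I2 j) => -> [] -> //=; rewrite setIC.
- by move=> i j; case: (I2 i) (I2 j) => -> [] -> //=; rewrite setIC.
exists g => k; rewrite (ord1 k).
by have [_ [[z /= /YI Iz <-] /YJ Jz]] := gYZ ord0; exists (val g z); split=> //; exists z.
Qed.

Lemma ext_aut_setM (u v : sym K) :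
  ext_aut_set u -> ext_aut_set v -> ext_aut_set (u * v).
Proof.
move=> [uP uS] [vP vS]; split; first exact: (group_closedM (aut_group_closed K)).
by move=> p; rewrite symME uS.
Qed.

Section Induction.
Context (n : nat) (I J : 'I_n.+3 -> set L) (c e : 'I_n.+3 -> L).
Hypotheses (L2 : exists x y : L, x <> y).
Hypotheses (IP : forall k, is_cinterval (I k)) (ce : forall k, c k <> e k)
  (JE : forall k, J k = cinterval (c k) (e k)).
Hypotheses (cI : Crs I) (cJ : Crs J).

Let hE := ext_aut_flexible hL L2 hom.
Let hK := completion_circle hL L2.
Local Notation dense := (emb_cyc_dense hL L2).

Let Crs_cyc (X : 'I_n.+3 -> set L) : Crs X -> forall i j k : 'I_n.+3,
  (i < j < k)%N -> forall x y z, X i x -> X j y -> X k z -> cyc x y z.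
Proof. by move=> []. Qed.

(** [Crs] has a separate meaning for two sets. With a third nonempty set, a common point of the
    first two would give a [cyc] relation with a repeated point. *)
Let Crs_disjoint (X : 'I_n.+3 -> set L) : Crs X ->
  X ord0 `&` X (inord 1) = set0.
Proof.
move=> hX; apply/seteqP; split=> // x [X0 X1].
have [z Xz] : X (inord 2) !=set0 by case: hX.
have lt : (@ord0 n.+2 < (inord 1 : 'I_n.+3) < (inord 2 : 'I_n.+3))%N by rewrite !inordK.
by have := Crs_cyc hX lt X0 X1 Xz; cyc_order.
Qed.

Let moves k (u : sym K) (x : 'I_n.+3 -> L) := forall i : 'I_n.+3, (i < k)%N ->
  I i (x i) /\ exists2 y, u (emb (x i)) = emb y & J i y.

Let start : exists u x, ext_aut_set u /\ moves 2 u x.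
Proof.
have I2 (i : 'I_2) : i = ord0 \/ i = ord_max.
  by case: i => -[|[|//]] h; [left|right]; exact/val_inj.
pose two (X : 'I_n.+3 -> set L) (i : 'I_2) := if i == ord0 then X ord0 else X (inord 1).
have two_disjoint X : Crs X -> Crs (two X).
  move=> /Crs_disjoint dis; rewrite /Crs /= => i j; rewrite /two.
  by case: (I2 i) (I2 j) => -> [] -> //=; rewrite setIC.
have [||||g gIJ] := hom (I := two I) (J := two J).
- by move=> i; rewrite /two; case: ifP.
- by move=> i; rewrite /two; case: ifP => _; rewrite JE; eexists; eexists; split.
- exact: two_disjoint.
- exact: two_disjoint.
have [_ [[z0 /= Iz0 <-] Jz0]] := gIJ ord0.
have [_ [[z1 /= Iz1 <-] Jz1]] := gIJ ord_max.
have gP : autrel_pred (val g) by apply/orP; left; exact: (valP g).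
exists (ext hL (val g)), (fun i => if i == ord0 then z0 else z1); split.
  by split; [exact: (ext_aut _ (valP g))|exact: ext_stabilizes].
move=> i i2; have [->|i1] : i = ord0 \/ i = inord 1.
- by case: i i2 => -[|[|//]] h _; [left|right]; apply/val_inj; rewrite /= ?inordK.
- by rewrite eqxx; split=> //; exists (val g z0) => //; exact: ext_emb.
have -> : (i == ord0) = false.
  by rewrite i1; apply/eqP => /(congr1 val); rewrite /= inordK.
by rewrite i1; split=> //; exists (val g z1) => //; exact: ext_emb.
Qed.

(** The images reached so far lie on the closed arc from [y0] to [yp], the first and the last of
    them. On the complementary arc both the image of a point of the next interval and the next
    target are found, so a correction supported there leaves the earlier images fixed. Two points
    are needed to bound that arc, hence the start at [k = 2]. *)
Let step k : (1 < k < n.+3)%N -> (exists u x, ext_aut_set u /\ moves k u x) ->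
  exists u x, ext_aut_set u /\ moves k.+1 u x.
Proof.
move=> /andP[k1 kn] [u [x [[uP uS] ux]]].
have k0 : (k.-1 < n.+3)%N by exact: leq_ltn_trans (leq_pred k) kn.
pose i0 : 'I_n.+3 := ord0; pose ip := Ordinal k0; pose ik := Ordinal kn.
have ipk : (ip < k)%N by rewrite /= ltn_predL (ltn_trans _ k1).
have [Ix0 [y0 uy0 Jy0]] := ux i0 (ltn_trans (ltn0Sn 0) k1).
have [Ixp [yp uyp Jyp]] := ux ip ipk.
have ord : (i0 < ip < ik)%N.
  by rewrite /= ltn_predL (ltnW k1) andbT -(ltn_predK k1) -ltnS (ltn_predK k1).
have uE p q r : cyc (u p) (u q) (u r) = cyc p q r by exact: orient_preservingE.
have [y Iy] : exists y, I ik y.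
  have [a [b [ab ->]]] := IP ik; have eab : emb a <> emb b by move/emb_inj.
  by have [y] := dense eab; exists y; rewrite /cinterval /= -cyc_emb.
have t_in : cyc (emb yp) (u (emb y)) (emb y0).
  rewrite -uyp -uy0 uE cyc_emb.
  by have := Crs_cyc cI ord Ix0 Ixp Iy; cyc_order.
have ece : emb (c ik) <> emb (e ik) by move/emb_inj; exact: ce.
have [z2 z2P] := dense ece.
have ecz : emb (c ik) <> emb z2 by move: z2P; cyc_order.
have [z1 z1P] := dense ecz.
have Jin z : cyc (emb (c ik)) (emb z) (emb (e ik)) -> J ik z.
  by rewrite JE /cinterval /= cyc_emb.
have in_arc z : J ik z -> cyc (emb yp) (emb z) (emb y0).
  by move=> Jz; rewrite cyc_emb; have := Crs_cyc cJ ord Jy0 Jyp Jz; cyc_order.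
have z1J : cyc (emb (c ik)) (emb z1) (emb (e ik)) by move: z1P z2P; cyc_order.
have nyp : ~ cyc (emb (c ik)) (emb yp) (emb (e ik)).
  by move=> /Jin/in_arc; cyc_order.
have [||v [[vP vS] vout vt]] := flex_between hK hE t_in (c := emb z1) (e := emb z2).
- by move: nyp z1P z2P (in_arc _ (Jin _ z1J)) (in_arc _ (Jin _ z2P)); cyc_order.
- exact/in_arc/Jin.
exists (v * u), (fun i => if i == ik then y else x i); split.
  by apply: ext_aut_setM.
move=> i; rewrite ltnS leq_eqVlt => /orP[/eqP ik'|ik'].
  have -> : i = ik by exact/val_inj.
  rewrite eqxx; split=> //; rewrite symME.
  have [w _ wE] : range (@emb d L) (v (u (emb y))).
    by rewrite vS uS; exists y.
  by exists w => //; apply: Jin; rewrite wE; move: vt z1P z2P; cyc_order.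
have -> : (i == ik) = false by apply/eqP => e'; move: ik'; rewrite e' ltnn.
have [Ii [w uw Jw]] := ux i ik'; split=> //; exists w => //.
rewrite symME uw vout // -uw -uyp -uy0 uE cyc_emb.
have [->|ni0] := eqVneq i i0; first by cyc_order.
have [->|nip] := eqVneq i ip; first by cyc_order.
have lt : (i0 < i < ip)%N.
  move: ni0 nip; rewrite -!val_eqE /= -lt0n => -> nip.
  by rewrite ltn_neqAle nip -ltnS prednK // (ltn_trans _ k1).
by have := Crs_cyc cI lt Ix0 Ii Ixp; cyc_order.
Qed.

Lemma Crs_homogeneous :
  exists g : Aut L, forall k, ((val g : L -> L) @` I k) `&` J k !=set0.
Proof.
have [u [x [[uP uS] ux]]] : exists u x, ext_aut_set u /\ moves n.+3 u x.
  have claim k : (k <= n.+1)%N -> exists u x, ext_aut_set u /\ moves k.+2 u x.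
    elim: k => [_|k IH kn]; first exact: start.
    by apply: step; [rewrite !ltnS|exact/IH/ltnW].
  exact: claim.
have uR : autrel_pred u by apply/orP; left.
have [g [gR gu /(_ uP) gA]] := restriction hL uR uS.
exists (Sub g gA) => k; have [Ik [y uy Jy]] := ux k (ltn_ord k).
exists y; split=> //; exists (x k) => //; rewrite SubK.
by apply: emb_inj; rewrite -uy -gu ext_emb.
Qed.

End Induction.

Theorem highly_homogeneous : highly_interval_homogeneous L.
Proof.
case=> [I J _ _ _ _|[|[|n]]]; first by exists 1 => -[].
- exact: interval_homogeneous1.
- exact: hom.
move=> I J hI hJ cI cJ.
have L2 : exists x y : L, x <> y by have [x [y [xy _]]] := hI ord0; exists x, y.
have [c /choice[e ceP]] := choice hJ.
exact: (Crs_homogeneous L2 hI (fun k => (ceP k).1) (fun k => (ceP k).2) cI cJ).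
Qed.

End HighHomogeneity.

(** * Conjugators *)

Section Conjugation.
Context {d : Order.disp_t} (L : orderType d).
Hypotheses (hL : is_circle L) (hom : interval_homogeneous L 2).
Local Notation K := (completion L).
Local Notation ext := (ext hL).

(** For Aut(C) and Aut(C^rel), [rho] will be extension to [K]; for the two groups of the completion
    itself it will be the inclusion. *)
Theorem unique_conjugator (G : groupType) (rho : G -> sym K) (phi : G -> G) :
  {morph rho : g h / g * h} -> injective rho -> (forall g, autrel_pred (rho g)) ->
  @ext_aut_set d L `<=` range rho -> is_aut phi ->
  exists! h : AutRel K, forall g, val h * rho g * (val h)^-1 = rho (phi g).
Proof.
move=> rhoM rhoI rho_rel rhoE phi_aut.
have [L2|K1] := nontrivial_or_trivial hL; last first.
  by exists 1; split=> [g|h _]; [|apply: val_inj]; apply: sym_eq => p; exact: K1.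
have hK := completion_circle hL L2; have hE := ext_aut_flexible hL L2 hom.
have [s sR sP] := aut_conjugation hK hE rhoM rhoI rho_rel rhoE phi_aut.
exists (Sub s sR); split=> [g|h hP]; first by rewrite SubK; exact: sP.
apply: val_inj; rewrite SubK.
exact: (conjugator_unique hK hE rhoM rhoI rho_rel rhoE sP hP).
Qed.

Lemma is_aut_id (G : groupType) : is_aut (@id G).
Proof. by split=> //; exists id. Qed.

Lemma is_aut_inv (G : groupType) (phi : G -> G) : is_aut phi ->
  exists psi, [/\ is_aut psi, cancel phi psi & cancel psi phi].
Proof.
move=> [[psi phiK psiK] phiM]; exists psi; split=> //; split; first by exists phi.
by move=> x y; apply: (can_inj phiK); rewrite phiM !psiK.
Qed.

Lemma is_aut_comp (G : groupType) (phi psi : G -> G) :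
  is_aut phi -> is_aut psi -> is_aut (phi \o psi).
Proof.
move=> [phiB phiM] [psiB psiM]; split; first exact: bij_comp.
by move=> x y /=; rewrite psiM phiM.
Qed.

Lemma is_aut_conj (G : groupType) (h : G) : is_aut (fun x => h * x * h^-1).
Proof.
split; last by move=> x y; rewrite !mulgA mulgVK.
exists (fun x => h^-1 * x * h) => x; first by rewrite !mulgA mulVg mul1g mulgVK.
by rewrite !mulgA mulgV mul1g mulgK.
Qed.

(** Both [1] and the image of a central element conjugate as the identity automorphism, so they
    agree by uniqueness of the conjugator. *)
Lemma central_trivial (G : groupType) (rho : G -> sym K) :
  {morph rho : g h / g * h} -> injective rho -> (forall g, autrel_pred (rho g)) ->
  @ext_aut_set d L `<=` range rho ->
  forall z : G, (forall x, z * x = x * z) -> z = 1.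
Proof.
move=> rhoM rhoI rhoR rhoE z zc.
have [h [_ hU]] := unique_conjugator rhoM rhoI rhoR rhoE (is_aut_id G).
have rho1 : rho 1 = 1 by apply: (@mulgI _ (rho 1)); rewrite -rhoM !mulg1.
apply: rhoI; rewrite rho1.
transitivity (val h).
  rewrite -[rho z](SubK (AutRel K) (rhoR z)); congr val.
  apply/esym/hU => g; rewrite SubK -rhoM zc rhoM; exact: mulgK.
by rewrite (hU 1) // => g; rewrite invg1 mulg1; exact: mul1g.
Qed.

(** * Groups between Aut(C) and Aut(C^rel), embedded by extension *)

Section ConjugationOfSubgroup.
Context {P : pred (sym L)} (G : subGroupType P).
Hypotheses (GR : forall g : G, autrel_pred (val g)) (GA : forall g, aut_pred g -> P g).
Let rho (g : G) := ext (val g).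

Let rhoR g : autrel_pred (rho g).
Proof. exact: ext_autrel. Qed.

Let rho_emb g x : rho g (emb x) = emb (val g x).
Proof. exact: ext_emb. Qed.

Lemma ext_valM : {morph rho : g h / g * h}.
Proof.
move=> g h; apply: (ext_unique hL) => //.
  by apply: (group_closedM (autrel_group_closed K)); exact: rhoR.
by move=> x; rewrite symME !rho_emb valM.
Qed.

Lemma ext_val_inj : injective rho.
Proof.
move=> g h gh; apply: val_inj; apply: sym_eq => x.
by apply: emb_inj; rewrite -!rho_emb gh.
Qed.

Lemma ext_val_range : @ext_aut_set d L `<=` range rho.
Proof.
move=> u [uP uS]; have uR : autrel_pred u by apply/orP; left.
have [g [gR gu /(_ uP) gA]] := restriction hL uR uS.
by exists (Sub g (GA gA)) => //; rewrite /rho SubK.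
Qed.

Definition conjugates (phi : G -> G) (h : AutRel K) :=
  forall g, val h * rho g * (val h)^-1 = rho (phi g).

Lemma extendsP (u : AutRel K) (g : G) : extends (val u) (val g) <-> val u = rho g.
Proof.
split=> [ug|-> x]; last exact: rho_emb.
apply: (ext_unique hL) => //; first exact: (valP u).
by move=> x; rewrite ug rho_emb.
Qed.

Lemma conj_byP (phi : G -> G) h : conj_by phi h <-> conjugates phi h.
Proof.
split=> [c g|c g].
  by have [u /extendsP ug /extendsP <-] := c g; rewrite -ug.
have [u uE] : exists u : AutRel K, val u = rho g.
  by exists (Sub (rho g) (rhoR g)); exact: SubK.
exists u; apply/extendsP => //; rewrite -c.
by rewrite -[LHS]/(val h * val u * (val h)^-1) uE.
Qed.

Lemma unique_conj_by (phi : G -> G) : is_aut phi -> exists! h : AutRel K, conj_by phi h.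
Proof.
move=> /(unique_conjugator ext_valM ext_val_inj rhoR ext_val_range)[h [hP hU]].
by exists h; split=> [|k /conj_byP]; [exact/conj_byP|exact: hU].
Qed.

Lemma trivial_center (z : G) : (forall x, z * x = x * z) -> z = 1.
Proof. exact: (central_trivial ext_valM ext_val_inj rhoR ext_val_range). Qed.

Lemma conjugates_act (phi : G -> G) h g p : conjugates phi h ->
  val h (rho g p) = rho (phi g) (val h p).
Proof.
move=> hP; have hK q : (val h)^-1 (val h q) = q by exact: symK.
by rewrite -hP !symME hK.
Qed.

Lemma extensionsP (u : AutRel K) : extensions G u <-> exists g, val u = rho g.
Proof. by split=> -[g ug]; exists g; [exact/extendsP|exact/extendsP]. Qed.

Lemma extension_of (g : G) : exists2 u : AutRel K, extensions G u & val u = rho g.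
Proof.
exists (Sub (rho g) (rhoR g)); last exact: SubK.
by apply/extensionsP; exists g; exact: SubK.
Qed.

Lemma conjugatorsP h : conjugators G h <->
  exists2 phi : G -> G, is_aut phi & conjugates phi h.
Proof. by split=> -[phi phiA phiP]; exists phi => //; exact/conj_byP. Qed.

Lemma ext_valV g : rho g^-1 = (rho g)^-1.
Proof.
have rho1 : rho 1 = 1 by apply: (@mulgI _ (rho 1)); rewrite -ext_valM !mulg1.
by apply: (@mulgI _ (rho g)); rewrite mulgV -ext_valM mulgV.
Qed.

Lemma is_subgroup_extensions : is_subgroup (extensions G).
Proof.
split.
  apply/mem_set/extensionsP; exists 1.
  by apply: (@mulgI _ (rho 1)); rewrite -ext_valM !mulg1.
move=> u v /set_mem/extensionsP[g ug] /set_mem/extensionsP[k vk].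
by apply/mem_set/extensionsP; exists (g / k); rewrite ext_valM ext_valV -ug -vk.
Qed.

Lemma extensions_conjugators : extensions G `<=` conjugators G.
Proof.
move=> u /extensionsP[g ug]; apply/conjugatorsP.
exists (fun x => g * x * g^-1); first exact: is_aut_conj.
by move=> x; rewrite !ext_valM ext_valV ug.
Qed.

Lemma conjugates_comp (phi psi : G -> G) h k :
  conjugates phi h -> conjugates psi k -> conjugates (phi \o psi) (h * k).
Proof.
move=> phiP psiP g; rewrite /= -phiP -psiP.
rewrite -[LHS]/(val h * val k * rho g * (val h * val k)^-1).
by rewrite invgM !mulgA.
Qed.

Lemma conjugates_inv (phi psi : G -> G) h :
  cancel psi phi -> conjugates phi h -> conjugates psi h^-1.
Proof.
move=> psiK phiP g; rewrite -[in LHS](psiK g) -phiP.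
rewrite -[LHS]/((val h)^-1 * (val h * rho (psi g) * (val h)^-1) * (val h)^-1^-1).
by rewrite invgK !mulgA mulVg mul1g mulgVK.
Qed.

Lemma is_subgroup_conjugators : is_subgroup (conjugators G).
Proof.
split.
  apply/mem_set/conjugatorsP; exists id; first exact: is_aut_id.
  by move=> g; rewrite invg1 mulg1; exact: mul1g.
move=> h k /set_mem/conjugatorsP[phi phiA phiP] /set_mem/conjugatorsP[psi psiA psiP].
have [psi' [psi'A _ psiK]] := is_aut_inv psiA.
apply/mem_set/conjugatorsP; exists (phi \o psi'); first exact: is_aut_comp.
exact/conjugates_comp/conjugates_inv.
Qed.

Section Image.
Context (phi : G -> G) (h : AutRel K).
Hypotheses (phiA : is_aut phi) (phiP : conjugates phi h).
Let M := val h @` range (@emb d L).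
Let hact g p : val h (rho g p) = rho (phi g) (val h p) := conjugates_act g p phiP.

(** By [hact], the action of [phi g] on [M] is the action of [g] on [C] carried over by [h]. As
    [phi] is onto, the orbits of the group in [M] are the images of its orbits in [C]. *)
Lemma image_orbit_like : orbit_like G M.
Proof.
have [psi [psiA phiK psiK]] := is_aut_inv phiA.
split.
  move=> _ [_ [x _ <-] <-] q [u /extensionsP[g ->] <-].
  rewrite -(psiK g) -hact rho_emb.
  by exists (emb (val (psi g) x)) => //; exists (val (psi g) x).
move=> [p0 p0E]; exists (val h p0); rewrite /M p0E; apply/seteqP; split.
  move=> _ [_ [u /extensionsP[g ->] <-] <-].
  have [v vG vE] := extension_of (phi g); exists v => //.
  by rewrite vE hact.
move=> _ [u /extensionsP[g ->] <-]; rewrite -(psiK g) -hact.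
exists (rho (psi g) p0) => //; have [v vG vE] := extension_of (psi g).
by exists v; rewrite ?vE.
Qed.

Lemma image_set_bij : set_bij [set: L] M (fun x => val h (emb x)).
Proof.
split.
- by move=> x _; exists (emb x) => //; exists x.
- by move=> x y _ _ /(can_inj (@symK _ (val h))) /emb_inj.
- by move=> _ [_ [x _ <-] <-]; exists x.
Qed.

Lemma image_iso : val h \in @orient_preserving _ K -> iso [set: L] M.
Proof.
move=> hP; exists (fun x => val h (emb x)); split; first exact: image_set_bij.
by move=> x y z _ _ _; rewrite orient_preservingE // cyc_emb.
Qed.

Lemma image_antiiso : val h \in @orient_reversing _ K -> antiiso [set: L] M.
Proof.
move=> /asboolP hP; exists (fun x => val h (emb x)); split; first exact: image_set_bij.
by move=> x y z _ _ _; rewrite hP cyc_emb.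
Qed.

Lemma extension_set_bij f :
  (exists2 u, extensions G u & forall p, M p -> (val u) p = f p) ->
  set_bij M M f.
Proof.
have [psi [psiA phiK psiK]] := is_aut_inv phiA.
have [stab _] := image_orbit_like.
move=> [u uG uf]; split.
- by move=> p Mp; rewrite -uf //; apply: (stab _ Mp); exists u.
- by move=> p q /set_mem Mp /set_mem Mq; rewrite -!uf // => /(can_inj (@symK _ (val u))).
- move: uG => /extensionsP[g ug] _ [_ [x _ <-] <-].
  have Mx y : M (val h (emb y)) by exists (emb y) => //; exists y.
  exists (val h (emb ((val (psi g))^-1 x))) => //.
  by rewrite -uf // ug -{1}(psiK g) -hact rho_emb symVE.
Qed.

(** [g] is [f] conjugated back by [h]. Whether [h] preserves or reverses, it enters twice, so [g]
    has the orientation behaviour of [f]. *)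
Lemma pull_back f : set_bij M M f -> exists g : sym L,
  [/\ forall x, val h (emb (g x)) = f (val h (emb x)),
      is_iso M M f -> g \in @orient_preserving _ L &
      is_antiiso M M f -> g \in @orient_reversing _ L].
Proof.
move=> [fM fI fS].
have Mx x : M (val h (emb x)) by exists (emb x) => //; exists x.
have hI x y : val h (emb x) = val h (emb y) -> x = y.
  by move=> /(can_inj (@symK _ (val h))) /emb_inj.
have /choice[g gP] x : exists y, val h (emb y) = f (val h (emb x)).
  by have [_ [y _ <-] <-] := fM _ (Mx x); exists y.
have /choice[k kP] x : exists y, f (val h (emb y)) = val h (emb x).
  by have [_ [_ [y _ <-] <-] <-] := fS _ (Mx x); exists y.
have gK : cancel g k.
  by move=> x; apply: hI; apply: fI; rewrite ?inE // kP gP.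
have kK : cancel k g by move=> x; apply: hI; rewrite gP kP.
exists (Sym gK kK); split=> [//|[_ fC]|[_ fC]]; apply/asboolP => x y z /=.
  rewrite -[LHS]cyc_emb -[RHS]cyc_emb; case: (autrelE (valP h)) => hC.
    by rewrite -hC !gP fC // hC.
  by rewrite -hC !gP fC // hC.
rewrite -[LHS]cyc_emb -[RHS]cyc_emb; case: (autrelE (valP h)) => hC.
  by rewrite -hC !gP fC // hC.
by rewrite -hC !gP fC // hC.
Qed.

(** On [M], the map [f] is the conjugate of [g] by [h], and this is the action of the group element
    [phi g]. *)
Lemma image_action f (g : sym L) (gG : P g) :
  (forall x, val h (emb (g x)) = f (val h (emb x))) ->
  exists2 u, extensions G u & forall p, M p -> (val u) p = f p.
Proof.
move=> gP; have [u uG uE] := extension_of (phi (Sub g gG)); exists u => //.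
by move=> _ [_ [x _ <-] <-]; rewrite uE -hact rho_emb SubK gP.
Qed.

Lemma image_trivial : M = range (@emb d L) ->
  exists g : sym L, [/\ autrel_pred g, ext g = val h & aut_pred (val h) -> aut_pred g].
Proof.
move=> ME; apply: restriction; first exact: (valP h).
move=> p; rewrite -[in X in X <-> _]ME; split=> [[q qL]|pL].
  by move=> /(can_inj (@symK _ (val h))) <-.
by exists p.
Qed.

End Image.

Lemma inner_of_restriction (phi : G -> G) h (g : sym L) (gG : P g) :
  conjugates phi h -> ext g = val h -> is_inner phi.
Proof.
move=> phiP gh; exists (Sub g gG) => x; apply: ext_val_inj.
have gE : rho (Sub g gG) = val h by rewrite /rho SubK.
by rewrite -phiP !ext_valM ext_valV gE.
Qed.

End ConjugationOfSubgroup.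
End Conjugation.

(** * Inner automorphisms and their cosets *)

Section OuterGroup.
Context (G : groupType).
Implicit Types (phi psi : G -> G).

Lemma is_inner_comp phi psi : is_inner phi -> is_inner psi -> is_inner (phi \o psi).
Proof.
move=> [g gP] [k kP]; exists (g * k) => x /=.
by rewrite gP kP invgM !mulgA.
Qed.

Lemma is_inner_id : is_inner (@id G).
Proof. by exists 1 => x; rewrite mul1g invg1 mulg1. Qed.

Lemma is_inner_inv psi : is_inner psi ->
  exists psi', [/\ is_inner psi', cancel psi psi' & cancel psi' psi].
Proof.
move=> [g gP]; exists (fun x => g^-1 * x * g); split.
- by exists g^-1 => x; rewrite invgK.
- by move=> x; rewrite gP !mulgA mulVg mul1g mulgVK.
- by move=> x; rewrite gP !mulgA mulgV mul1g mulgK.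
Qed.

Lemma inner_coset phi psi : is_inner psi ->
  [set phi \o psi \o k | k in [set k | is_inner k]] =
  [set phi \o k | k in [set k : G -> G | is_inner k]].
Proof.
move=> psiI; apply/seteqP; split=> _ [k kI <-].
  by exists (psi \o k) => //; exact: is_inner_comp.
have [psi' [psi'I _ psiK]] := is_inner_inv psiI.
exists (psi' \o k); first exact: is_inner_comp.
by apply/funext => x /=; rewrite psiK.
Qed.

(** [f] marks each coset by whether it contains an inner automorphism. The cosets that do all
    coincide, and the hypotheses on [pos] make the remaining ones coincide as well, so [f] is
    injective on [Outer G]. *)
Lemma Outer_le2 (pos : set (G -> G)) :
  (forall phi, is_aut phi -> pos phi -> is_inner phi) ->
  (forall phi psi, is_aut phi -> is_aut psi -> ~ pos phi -> ~ pos psi ->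
     exists2 k, is_inner k & psi = phi \o k) ->
  Outer G #<= `I_2.
Proof.
move=> pos_inner neg_inner.
pose f (A : set (G -> G)) : nat :=
  if `[< exists2 phi, A phi & is_inner phi >] then 0%N else 1%N.
have f2 A : (f A < 2)%N by rewrite /f; case: ifP.
rewrite -(card_le_eql (@inj_card_eq _ _ (Outer G) f _)).
  by apply: subset_card_le => _ [A _ <-] /=.
move=> A B /set_mem[phi phiA <-] /set_mem[psi psiA <-].
have inner_of (k : G -> G) :
    (exists2 u, [set k \o j | j in [set j | is_inner j]] u & is_inner u) ->
    is_inner k.
  move=> [_ [j jI <-] kj]; have [j' [j'I _ jK]] := is_inner_inv jI.
  have -> : k = (k \o j) \o j' by apply/funext => x /=; rewrite jK.
  exact: is_inner_comp.
have of_inner (k : G -> G) : is_inner k ->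
    exists2 u, [set k \o j | j in [set j | is_inner j]] u & is_inner u.
  by move=> kI; exists k => //; exists id => //; exact: is_inner_id.
have [phiI|phiI] := pselect (is_inner phi).
  have [psiI _|psiI] := pselect (is_inner psi).
    have e (k : G -> G) : is_inner k -> [set k \o j | j in [set j | is_inner j]] =
        [set id \o j | j in [set j : G -> G | is_inner j]].
      by move=> kI; exact: (inner_coset id kI).
    by rewrite !e.
  by rewrite /f (asboolT (of_inner _ phiI)) asboolF // => /inner_of.
have [psiI|psiI] := pselect (is_inner psi).
  by rewrite /f (asboolT (of_inner _ psiI)) asboolF // => /inner_of.
move=> _; have [||||k kI ->] := neg_inner phi psi => //.
- by move=> /(pos_inner _ phiA).
- by move=> /(pos_inner _ psiA).
by rewrite inner_coset.
Qed.

End OuterGroup.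

(** * Automorphism groups of Aut(C), Aut(C^rel) and of the completion *)

Section Final.
Context {d : Order.disp_t} (L : orderType d).
Hypotheses (hL : is_circle L) (hom : interval_homogeneous L 2).
Local Notation K := (completion L).

Let autR (g : Aut L) : autrel_pred (val g).
Proof. by apply/orP; left; exact: (valP g). Qed.

Let autA (g : sym L) : aut_pred g -> aut_pred g. Proof. exact. Qed.

Let relR (g : AutRel L) : autrel_pred (val g). Proof. exact: (valP g). Qed.

Let relA (g : sym L) : aut_pred g -> autrel_pred g.
Proof. by move=> gA; apply/orP; left. Qed.

Lemma orient_preserving_conj (h u : sym K) : autrel_pred h ->
  u \in @orient_preserving _ K -> h * u * h^-1 \in @orient_preserving _ K.
Proof.
move=> /autrelE hC /asboolP uC; apply/asboolP => x y z; rewrite !symME.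
by case: hC => hC; rewrite hC uC -hC !symVE.
Qed.

Lemma orient_preserving_ext (g : sym L) : autrel_pred g ->
  ext hL g \in @orient_preserving _ K -> aut_pred g.
Proof.
move=> gR /asboolP gC; apply/asboolP => x y z.
by rewrite -[LHS]cyc_emb -[RHS]cyc_emb -!(ext_emb hL _ gR) gC.
Qed.

(** Conjugation by [h] keeps orientation-preserving maps orientation-preserving, so an automorphism
    of Aut(C^rel) maps Aut(C) into itself. The same holds for its inverse, which makes the
    restriction bijective. *)
Lemma conjugators_sub : conjugators (AutRel L) `<=` conjugators (Aut L).
Proof.
move=> h /(conjugatorsP hL relR)[phi phiA phiP].
apply/(conjugatorsP hL autR).
have [psi [psiA phiK psiK]] := is_aut_inv phiA.
pose incl (g : Aut L) : AutRel L := Sub (val g) (autR g).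
have lift (k : AutRel L -> AutRel L) (w : AutRel K) : conjugates hL k w ->
    exists f : Aut L -> Aut L, forall g, incl (f g) = k (incl g).
  move=> kP.
  have /choice[f fP] (g : Aut L) : exists g' : Aut L, val g' = val (k (incl g)).
    have kg : aut_pred (val (k (incl g))).
      apply: orient_preserving_ext; first exact: relR.
      have := kP (incl g); rewrite /= => <-.
      apply: orient_preserving_conj; first exact: (valP w).
      exact: (ext_aut hL (valP g)).
    by exists (Sub _ kg); rewrite SubK.
  by exists f => g; apply: val_inj; exact: fP.
have inclI : injective incl by move=> g k /(congr1 val) gk; apply: val_inj; exact: gk.
have [f fP] := lift _ _ phiP.
have [f' f'P] := lift _ _ (conjugates_inv psiK phiP).
exists f; last by move=> g; have := phiP (incl g); rewrite -fP.
split; first by exists f' => g; apply: inclI; rewrite ?(fP, f'P) ?phiK ?psiK // fP psiK.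
move=> g k; apply: inclI; rewrite fP.
have -> : incl (g * k) = incl g * incl k by apply: val_inj.
by rewrite phiA.2 -!fP; apply: val_inj.
Qed.

Lemma orientP (h : AutRel K) : val h \in @orient_preserving _ K \/
  val h \in @orient_reversing _ K.
Proof. by have /orP := valP h. Qed.

Lemma aut_full_action (phi : Aut L -> Aut L) h : is_aut phi ->
  conjugates hL phi h -> full_action (Aut L) (val h @` range (@emb d L)).
Proof.
move=> phiA phiP f; split=> [fM|uf].
  have [g [gE gC _]] := pull_back fM.1.
  exact: (image_action autR phiP (gC fM) gE).
split; first exact: (extension_set_bij autR phiA phiP).
have [u /(extensionsP hL autR)[g ug] ufE] := uf.
have uC : val u \in @orient_preserving _ K by rewrite ug; exact: (ext_aut hL (valP g)).
by move=> x y z Mx My Mz; rewrite -!ufE // orient_preservingE.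
Qed.

Lemma autrel_full_action (phi : AutRel L -> AutRel L) h : is_aut phi ->
  conjugates hL phi h -> full_action_rel (AutRel L) (val h @` range (@emb d L)).
Proof.
move=> phiA phiP f; split=> [fM|uf].
  have fB : set_bij (val h @` range (@emb d L)) (val h @` range (@emb d L)) f.
    by case: fM => -[].
  have [g [gE gC gC']] := pull_back fB.
  suff gR : autrel_pred g by exact: (image_action relR phiP gR gE).
  by apply/orP; case: fM => [/gC|/gC']; [left|right].
have fB := extension_set_bij relR phiA phiP uf.
have [u _ ufE] := uf.
have [uC|/asboolP uC] := orientP u; [left|right]; split=> // x y z Mx My Mz.
  by rewrite -!ufE // orient_preservingE.
by rewrite -!ufE // uC.
Qed.

Lemma aut_inner (phi : Aut L -> Aut L) (h : AutRel K) :
  ~ (exists M, [/\ orbit_like (Aut L) M, M <> range (@emb d L),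
                   iso [set: L] M & full_action (Aut L) M]) ->
  is_aut phi -> conjugates hL phi h -> val h \in @orient_preserving _ K ->
  is_inner phi.
Proof.
move=> nM phiA phiP hC.
have [ME|MN] := pselect (val h @` range (@emb d L) = range (@emb d L)).
  have [g [_ gh /(_ hC) gA]] := image_trivial hL ME.
  exact: (inner_of_restriction autR gA phiP gh).
case: nM; exists (val h @` range (@emb d L)); split=> //.
- exact: (image_orbit_like autR phiA phiP).
- exact: image_iso.
- exact: aut_full_action phiP.
Qed.

(** Automorphisms with an orientation-preserving conjugator are inner by [aut_inner]. Two
    automorphisms with reversing conjugators differ by one whose conjugator is preserving, hence by
    an inner one. *)
Lemma aut_Outer :
  ~ (exists M, [/\ orbit_like (Aut L) M, M <> range (@emb d L),
                   iso [set: L] M & full_action (Aut L) M]) ->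
  Outer (Aut L) #<= `I_2.
Proof.
move=> nM; have conj (phi : Aut L -> Aut L) : is_aut phi -> exists h, conjugates hL phi h.
  move=> phiA; have [h [hP _]] := unique_conj_by hL hom autR autA phiA.
  by exists h; exact/(conj_byP hL autR).
apply: (@Outer_le2 _ [set phi | exists2 h, conjugates hL phi h &
  val h \in @orient_preserving _ K]) => [phi phiA [h hP hC]|].
  exact: aut_inner phiA hP hC.
move=> phi psi phiA psiA nphi npsi.
have [h hP] := conj _ phiA; have [k kP] := conj _ psiA.
have [hC|hC] := orientP h; first by case: nphi; exists h.
have [kC|kC] := orientP k; first by case: npsi; exists k.
have [phi' [phi'A phiK phi'K]] := is_aut_inv phiA.
exists (phi' \o psi); last by apply/funext => x /=; rewrite phi'K.
apply: (aut_inner nM (is_aut_comp phi'A psiA)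
  (conjugates_comp (conjugates_inv phi'K hP) kP)).
move: hC kC => /asboolP hC /asboolP kC; apply/asboolP => x y z.
rewrite -[LHS]hC -[RHS]kC.
have hK p : val h (val (h^-1 * k) p) = val k p by exact: (symVE (val h)).
by rewrite !hK.
Qed.

(** The anti-isomorphic alternative includes [M = C]. On a circle with more than one point,
    conjugation by an orientation-reversing automorphism of [C] is not inner in Aut(C), by
    uniqueness of the conjugator, so this case has to be excluded too. *)
Lemma aut_complete :
  ~ (exists M, [/\ orbit_like (Aut L) M,
                   (M <> range (@emb d L) /\ iso [set: L] M) \/ antiiso [set: L] M
                 & full_action (Aut L) M]) ->
  complete_group (Aut L).
Proof.
move=> nM; split.
  exact: (trivial_center hL hom autR autA).
move=> phi phiA; have [h [/(conj_byP hL autR) hP _]] :=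
  unique_conj_by hL hom autR autA phiA.
have [hC|hC] := orientP h.
  apply: (aut_inner _ phiA hP hC) => -[M [MO MN MI MF]].
  by apply: nM; exists M; split=> //; left.
case: nM; exists (val h @` range (@emb d L)); split.
- exact: (image_orbit_like autR phiA hP).
- by right; exact: image_antiiso.
- exact: aut_full_action hP.
Qed.

(** If [h] maps [C] onto itself, it restricts to a member of Aut(C^rel) even when it reverses
    orientation. Only images [M] different from [C] have to be excluded. *)
Lemma autrel_complete :
  ~ (exists M, [/\ orbit_like (AutRel L) M, M <> range (@emb d L),
                   iso [set: L] M \/ antiiso [set: L] M
                 & full_action_rel (AutRel L) M]) ->
  complete_group (AutRel L).
Proof.
move=> nM; split.
  exact: (trivial_center hL hom relR relA).
move=> phi phiA; have [h [/(conj_byP hL relR) hP _]] :=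
  unique_conj_by hL hom relR relA phiA.
have [ME|MN] := pselect (val h @` range (@emb d L) = range (@emb d L)).
  have [g [gR gh _]] := image_trivial hL ME.
  exact: (inner_of_restriction relR gR hP gh).
case: nM; exists (val h @` range (@emb d L)); split=> //.
- exact: (image_orbit_like relR phiA hP).
- by have [hC|hC] := orientP h; [left; exact: image_iso|right; exact: image_antiiso].
- exact: autrel_full_action hP.
Qed.

Lemma completion_conjugator (phi : Aut K -> Aut K) : is_aut phi ->
  exists! h : AutRel K, forall g, val (phi g) = val h * val g * (val h)^-1.
Proof.
move=> phiA.
have rel (g : Aut K) : autrel_pred (val g) by apply/orP; left; exact: (valP g).
have emb_range : @ext_aut_set d L `<=` range (val : Aut K -> sym K).
  by move=> u [uP _]; exists (Sub u uP).
have mor : {morph (val : Aut K -> sym K) : g h / g * h} by [].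
have [h [hP hU]] := unique_conjugator hL hom mor val_inj rel emb_range phiA.
by exists h; split=> [g|k kP]; [rewrite hP|apply: hU => g; rewrite kP].
Qed.

Lemma completion_conjugation (h : AutRel K) :
  exists2 phi : Aut K -> Aut K, is_aut phi &
    forall g, val (phi g) = val h * val g * (val h)^-1.
Proof.
have lift (w : AutRel K) : exists f : Aut K -> Aut K,
    forall g, val (f g) = val w * val g * (val w)^-1.
  have /choice[f fP] (g : Aut K) : exists g' : Aut K, val g' = val w * val g * (val w)^-1.
    have wP : aut_pred (val w * val g * (val w)^-1).
      exact: orient_preserving_conj (valP w) (valP g).
    by exists (Sub _ wP); rewrite SubK.
  by exists f.
have [f fP] := lift h; have [k kP] := lift h^-1.
have hV : val h^-1 = (val h)^-1 by [].
exists f => //; split.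
  exists k => g; apply: val_inj.
    by rewrite kP fP hV invgK !mulgA mulVg mul1g mulgVK.
  by rewrite fP kP hV invgK !mulgA mulgV mul1g mulgK.
move=> g g'; apply: val_inj; rewrite fP.
rewrite -[RHS]/(val (f g) * val (f g')) !fP -[val (g * g')]/(val g * val g').
by rewrite !mulgA mulgVK.
Qed.

(** The conjugator provided by [unique_conjugator] is already an element of the group, so every
    automorphism is inner. *)
Lemma completion_complete : complete_group (AutRel K).
Proof.
have rel (g : AutRel K) : autrel_pred (val g) by exact: (valP g).
have emb_range : @ext_aut_set d L `<=` range (val : AutRel K -> sym K).
  move=> u [uP _]; have uR : autrel_pred u by apply/orP; left.
  by exists (Sub u uR).
have mor : {morph (val : AutRel K -> sym K) : g h / g * h} by [].
split; first exact: (central_trivial hL hom mor val_inj rel emb_range).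
move=> phi phiA.
have [h [hP _]] := unique_conjugator hL hom mor val_inj rel emb_range phiA.
by exists h => g; apply: val_inj; rewrite -hP.
Qed.

End Final.

Theorem theorem9p5 (d : Order.disp_t) (L : orderType d) :
  is_circle L -> interval_homogeneous L 2 ->
  highly_interval_homogeneous L /\
  (* (1) *)
  [/\ (forall phi : Aut L -> Aut L, is_aut phi ->
         exists! h : AutRel (completion L), conj_by phi h),
      (forall phi : AutRel L -> AutRel L, is_aut phi ->
         exists! h : AutRel (completion L), conj_by phi h)
    & [/\ is_subgroup (extensions (AutRel L)),
          is_subgroup (conjugators (AutRel L)),
          is_subgroup (conjugators (Aut L)),
          extensions (AutRel L) `<=` conjugators (AutRel L)
        & conjugators (AutRel L) `<=` conjugators (Aut L)]] /\
  (* (2) *)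
  [/\ (~ (exists M, [/\ orbit_like (Aut L) M, M <> range (@emb d L),
                        iso [set: L] M & full_action (Aut L) M]) ->
         Outer (Aut L) #<= `I_2),
      (~ (exists M, [/\ orbit_like (Aut L) M,
                        (M <> range (@emb d L) /\ iso [set: L] M) \/
                          antiiso [set: L] M
                      & full_action (Aut L) M]) ->
         complete_group (Aut L))
    & (~ (exists M, [/\ orbit_like (AutRel L) M, M <> range (@emb d L),
                        iso [set: L] M \/ antiiso [set: L] M
                      & full_action_rel (AutRel L) M]) ->
         complete_group (AutRel L))] /\
  (* (3) *)
  [/\ (forall phi : Aut (completion L) -> Aut (completion L), is_aut phi ->
         exists! h : AutRel (completion L),
           forall g, val (phi g) = val h * val g * (val h)^-1),
      (forall h : AutRel (completion L),
         exists2 phi : Aut (completion L) -> Aut (completion L), is_aut phi &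
           forall g, val (phi g) = val h * val g * (val h)^-1)
    & complete_group (AutRel (completion L))].
Proof.
move=> hL hom.
have autR (g : Aut L) : autrel_pred (val g) by apply/orP; left; exact: (valP g).
have relR (g : AutRel L) : autrel_pred (val g) by exact: (valP g).
have relA (g : sym L) : aut_pred g -> autrel_pred g by move=> gA; apply/orP; left.
split; first exact: highly_homogeneous.
split; last split.
- split.
  + exact: (unique_conj_by hL hom autR).
  + exact: (unique_conj_by hL hom relR).
  + split.
    * exact: (is_subgroup_extensions hL relR).
    * exact: (is_subgroup_conjugators hL relR).
    * exact: (is_subgroup_conjugators hL autR).
    * exact: (extensions_conjugators hL relR).
    * exact: conjugators_sub.
- split; [exact: aut_Outer|exact: aut_complete|exact: autrel_complete].
- split; [exact: completion_conjugator|exact: completion_conjugation|].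
  exact: completion_complete.
Qed.
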